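(* Let $\mathbb F\in\{\mathbb R,\mathbb C\}$. (i) A pencil $L(\lambda)\in\mathbb F^{n,n}[\lambda]$ is equivalent over $\mathbb F$ to a pencil of the form $P(\lambda)=\lambda E-(J-R)Q$ with $E,J,R,Q\in\mathbb F^{n,n}$, $J^*=-J$, $R^*=R\ge 0$, $Q^*E=E^*Q\ge 0$ and with the pencil $\lambda E-Q$ being regular, if and only if all of the following conditions are satisfied: (a) the spectrum of $L(\lambda)$ (its finite eigenvalues) is contained in the closed left half plane; (b) the finite nonzero eigenvalues on the imaginary axis are semisimple and the partial multiplicities of the eigenvalue zero are at most two; (c) the index of $L(\lambda)$ is at most two; (d) the left minimal indices are all zero and the right minimal indices are at most one (if there are any). (ii) A pencil $L(\lambda)\in\mathbb F^{n,n}[\lambda]$ is equivalent over $\mathbb F$ to a pencil of the form $P(\lambda)=\lambda E-(J-R)$ with $E,J,R\in\mathbb F^{n,n}$, $J^*=-J$, $R^*=R\ge 0$, $E=E^*\ge 0$, if and only if all of the following conditions are satisfied: (a) the spectrum of $L(\lambda)$ (its finite eigenvalues) is contained in the closed left half plane; (b) the finite eigenvalues on the imaginary axis (including zero) are semisimple; (c) the index of $L(\lambda)$ is at most two; (d) the left and right minimal indices are all zero (if there are any).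
   Context: A pencil in $\mathbb F^{n,n}[\lambda]$ is $\lambda E-A$ with $E,A\in\mathbb F^{n,n}$; it need not be regular. $M^*$ is the conjugate transpose; $M\ge 0$ means Hermitian positive semidefinite. Two pencils $L,\tilde L\in\mathbb F^{n,n}[\lambda]$ are equivalent (over $\mathbb F$) if $L(\lambda)=S\tilde L(\lambda)T$ for constant invertible $S,T\in\mathbb F^{n,n}$. A pencil is regular if it is square and its determinant is not identically zero. Kronecker canonical form: every pencil is equivalent over $\mathbb C$ to a block diagonal pencil, unique up to permutation of blocks, with blocks of the following types: $\mathcal L_\epsilon=\lambda[\,I_\epsilon\;0\,]-[\,0\;I_\epsilon\,]$ of size $\epsilon\times(\epsilon+1)$, $\epsilon\ge 0$; transposes $\mathcal L_\eta^\top$ of size $(\eta+1)\times\eta$, $\eta\ge 0$; $\lambda I_\rho-\mathcal J_\rho(\lambda_i)$; and $\lambda\mathcal J_\sigma(0)-I_\sigma$; here $\mathcal J_k(\lambda_0)$ is the upper triangular $k\times k$ Jordan block with eigenvalue $\lambda_0$. The numbers $\epsilon$ are the right minimal indices and the numbers $\eta$ the left minimal indices. The $\lambda_i\in\mathbb C$ are the finite eigenvalues; the sizes $\rho$ of the blocks belonging to a given finite eigenvalue are its partial multiplicities; a finite eigenvalue is semisimple if all its partial multiplicities equal one. The index is the largest size $\sigma$ of a block $\lambda\mathcal J_\sigma(0)-I_\sigma$ (and $0$ if there are no such blocks). *)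

(* Defs.v *)
From HB Require Import structures.
From mathcomp Require Import all_boot all_order all_algebra.
From mathcomp Require Import boolp classical_sets reals.
From mathcomp.real_closed Require Import complex.

Set Implicit Arguments.
Unset Strict Implicit.
Unset Printing Implicit Defensive.

Import Order.TTheory GRing.Theory Num.Theory.
Local Open Scope ring_scope.
Local Open Scope complex_scope.

(** * The ground field [F], real or complex *)

Variant ground := RealField | ComplexField.

Definition ground_field (R : realType) (k : ground) : numFieldType :=
  match k with RealField => R | ComplexField => R[i] end.

Definition ground_conj (R : realType) (k : ground) :
    ground_field R k -> ground_field R k :=
  match k return ground_field R k -> ground_field R k with
  | RealField => id
  | ComplexField => @conjc R
  end.

Definition to_complex (R : realType) (k : ground) : ground_field R k -> R[i] :=
  match k return ground_field R k -> R[i] with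
  | RealField => real_complex R
  | ComplexField => id
  end.

Definition adjmx (R : realType) (k : ground) (m n : nat)
    (A : 'M[ground_field R k]_(m, n)) : 'M[ground_field R k]_(n, m) :=
  (map_mx (@ground_conj R k) A)^T.

(* In R[i], [0 <= z] means that z is real and nonnegative. *)
Definition psdmx (R : realType) (k : ground) (n : nat)
    (M : 'M[ground_field R k]_n) : Prop :=
  adjmx M = M /\
  forall x : 'cV[ground_field R k]_n, 0 <= (adjmx x *m M *m x) 0 0.

(** * Matrix pencils, as matrices of polynomials in the variable ['X] *)

Definition pencil (F : fieldType) (m n : nat) (E A : 'M[F]_(m, n)) :
    'M[{poly F}]_(m, n) :=
  'X *: map_mx polyC E - map_mx polyC A.

Definition regular_pencil (F : fieldType) (n : nat) (L : 'M[{poly F}]_n) :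
    Prop :=
  \det L != 0.

Definition pencil_equiv (F : fieldType) (n : nat) (L L' : 'M[{poly F}]_n) :
    Prop :=
  exists S T : 'M[F]_n,
    [/\ S \in unitmx, T \in unitmx
      & L = map_mx polyC S *m L' *m map_mx polyC T].

(** * Kronecker canonical form *)

Inductive kblock (C : Type) :=
  | KRight of nat          (* epsilon x (epsilon + 1) *)
  | KLeft of nat           (* (eta + 1) x eta *)
  | KFinite of nat & C     (* size rho, eigenvalue z *)
  | KInfinite of nat.      (* size sigma *)
Arguments KRight {C}.
Arguments KLeft {C}.
Arguments KInfinite {C}.

HB.instance Definition _ (C : Type) := gen_eqMixin (kblock C).
HB.instance Definition _ (C : Type) := gen_choiceMixin (kblock C).

(* Minimal indices may vanish, the sizes of the other blocks may not. *)
Definition kblock_wf (C : Type) (b : kblock C) : bool :=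
  match b with
  | KRight _ | KLeft _ => true
  | KFinite rho _ => (0 < rho)%N
  | KInfinite sigma => (0 < sigma)%N
  end.

Definition krows (C : Type) (b : kblock C) : nat :=
  match b with
  | KRight eps => eps
  | KLeft eta => eta.+1
  | KFinite rho _ => rho
  | KInfinite sigma => sigma
  end.

Definition kcols (C : Type) (b : kblock C) : nat :=
  match b with
  | KRight eps => eps.+1
  | KLeft eta => eta
  | KFinite rho _ => rho
  | KInfinite sigma => sigma
  end.

Definition jordan_block (C : fieldType) (k : nat) (z : C) : 'M[C]_k :=
  \matrix_(i, j) (z *+ (i == j) + (i.+1 == j :> nat)%:R).

Definition right_block (C : fieldType) (eps : nat) :
    'M[{poly C}]_(eps, eps.+1) :=
  pencil (\matrix_(i, j) (i == j :> nat)%:R)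
         (\matrix_(i, j) (i.+1 == j :> nat)%:R).

Definition kblock_mx (C : fieldType) (b : kblock C) :
    'M[{poly C}]_(krows b, kcols b) :=
  match b return 'M[{poly C}]_(krows b, kcols b) with
  | KRight eps => right_block C eps
  | KLeft eta => (right_block C eta)^T
  | KFinite rho z => pencil 1%:M (jordan_block rho z)
  | KInfinite sigma => pencil (jordan_block sigma 0) 1%:M
  end.

Fixpoint kdiag_mx (C : fieldType) (s : seq (kblock C)) :
    'M[{poly C}]_(sumn (map (@krows C) s), sumn (map (@kcols C) s)) :=
  match s with
  | [::] => 0
  | b :: s' => block_mx (kblock_mx b) 0 0 (kdiag_mx s')
  end.

Definition kronecker_form (C : fieldType) (n : nat) (L : 'M[{poly C}]_n)
    (s : seq (kblock C)) : Prop :=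
  all (@kblock_wf C) s /\
  exists e : (sumn (map (@krows C) s) = n) * (sumn (map (@kcols C) s) = n),
    pencil_equiv L (castmx e (kdiag_mx s)).

(** * Invariants of a pencil over [F], read off its Kronecker form over R[i] *)

(* The list of blocks is unique only up to permutation; none of the notions
   below depends on the order. The default [::] is never reached for a pencil
   lambda E - A, which always has a Kronecker form over R[i]. *)
Definition kcf (R : realType) (k : ground) (n : nat)
    (L : 'M[{poly ground_field R k}]_n) : seq (kblock R[i]) :=
  xget [::] [set s | kronecker_form
                       (map_mx (map_poly (@to_complex R k)) L) s]%classic.

Section Invariants.
Variables (R : realType) (k : ground) (n : nat).
Variable L : 'M[{poly ground_field R k}]_n.

Definition right_minimal_index (eps : nat) : Prop := KRight eps \in kcf L.

Definition left_minimal_index (eta : nat) : Prop := KLeft eta \in kcf L.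

Definition partial_multiplicity (z : R[i]) (rho : nat) : Prop :=
  KFinite rho z \in kcf L.

Definition finite_eigenvalue (z : R[i]) : Prop :=
  exists rho, partial_multiplicity z rho.

Definition semisimple (z : R[i]) : Prop :=
  forall rho, partial_multiplicity z rho -> rho = 1%N.

Definition pencil_index : nat :=
  \max_(b <- kcf L) (if b is KInfinite sigma then sigma else 0%N).

End Invariants.

(* Main.v *)
(* Up to equivalence, both structures amount to the existence of a matrix Q with
   Q^*E hermitian nonnegative and Q^*A dissipative: A = K Q with K dissipative
   can be solved as soon as ker Q is contained in ker A, and lambda E - Q is
   regular iff ker E and ker Q meet trivially, its value at -1 being then
   invertible. In part (ii) Q is moreover invertible.

   Necessity: each Kronecker block provides chains of vectors, on which these
   conditions force Q^*E to vanish on the first vectors. For an invertible Q this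
   is already a contradiction. In general the range of (E, Q) is Lagrangian, so
   that a vector x with Q^*Ex = 0 can be moved to some x' with Ex' = 0 and
   Ax' = Ax; pairing with a chain of left vectors gives the contradiction.

   Sufficiency over the complex numbers is obtained block by block. Over the
   reals, the pencil splits into real singular and infinite blocks and one pencil
   lambda I - A; the conditions pass to this splitting because the necessity
   part applies to every Kronecker form, so no uniqueness is needed. For
   lambda I - A the conditions on Q are convex and invariant under conjugation,
   and the real part of a complex solution is a real solution.

   Kronecker forms exist over any field up to the part lambda I - A: splitting off
   the kernel of the leading matrix leaves a smaller pencil D and a coupling term
   that matters only on the kernel of the leading matrix of D, where it is
   injective and can be normalized by row operations alone. Jordan forms follow by
   applying this to the pencil (A - z I, I), which moves the eigenvalue z to
   infinity. *)

Require Import Defs.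
From HB Require Import structures.
From mathcomp Require Import all_boot all_order all_algebra.
From mathcomp Require Import boolp classical_sets reals.
From mathcomp.real_closed Require Import complex.
From mathcomp Require Import zify ring lra.

Set Implicit Arguments.
Unset Strict Implicit.
Unset Printing Implicit Defensive.

Import Order.TTheory GRing.Theory Num.Theory.
Local Open Scope ring_scope.
Local Open Scope complex_scope.

(** * The category of pencils *)

Record pen (F : fieldType) := Pen {
  prow : nat;
  pcol : nat;
  pE : 'M[F]_(prow, pcol);
  pA : 'M[F]_(prow, pcol) }.

Section Pencils.
Variable F : fieldType.
Implicit Types P Q : pen F.

(* [S] acts on the row side and [T] on the column side. *)
Definition phom P Q (S : 'M_(prow Q, prow P)) (T : 'M_(pcol Q, pcol P)) :=
  S *m pE P = pE Q *m T /\ S *m pA P = pA Q *m T.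

Definition piso P Q :=
  exists (S : 'M_(prow Q, prow P)) (S' : 'M_(prow P, prow Q))
         (T : 'M_(pcol Q, pcol P)) (T' : 'M_(pcol P, pcol Q)),
    [/\ S *m S' = 1%:M, S' *m S = 1%:M, T *m T' = 1%:M, T' *m T = 1%:M
      & phom S T].

(** A retract of pencils. Column vectors of [P] are carried to [Q] by [S] and [T], row vectors by
    [S'] and [T'], and pairings between them are preserved. *)
Definition psummand P Q :=
  exists (S : 'M_(prow Q, prow P)) (S' : 'M_(prow P, prow Q))
         (T : 'M_(pcol Q, pcol P)) (T' : 'M_(pcol P, pcol Q)),
    [/\ S' *m S = 1%:M, T' *m T = 1%:M, phom S T & phom S' T'].

Definition padd P Q := Pen (block_mx (pE P) 0 0 (pE Q))
                           (block_mx (pA P) 0 0 (pA Q)).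

Definition pzero : pen F := @Pen F 0 0 0 0.

Definition ptr P := Pen (pE P)^T (pA P)^T.

Definition pfin n (A : 'M[F]_n) := Pen 1%:M A.

Lemma phom_id P : @phom P P 1%:M 1%:M.
Proof. by split; rewrite mul1mx mulmx1. Qed.

Lemma phom_comp P Q Z S1 T1 S2 T2 :
  @phom P Q S1 T1 -> @phom Q Z S2 T2 -> phom (S2 *m S1) (T2 *m T1).
Proof.
move=> [e1 a1] [e2 a2]; split.
  by rewrite -mulmxA e1 mulmxA e2 mulmxA.
by rewrite -mulmxA a1 mulmxA a2 mulmxA.
Qed.

Lemma phom_inv P Q S S' T T' : @phom P Q S T ->
  S' *m S = 1%:M -> T *m T' = 1%:M -> @phom Q P S' T'.
Proof.
move=> [e a] SS TT; split.
  by rewrite -[pE Q]mulmx1 -TT (mulmxA (pE Q)) -e !mulmxA SS mul1mx.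
by rewrite -[pA Q]mulmx1 -TT (mulmxA (pA Q)) -a !mulmxA SS mul1mx.
Qed.

Lemma piso_refl P : piso P P.
Proof. by exists 1%:M, 1%:M, 1%:M, 1%:M; rewrite !mulmx1; split => //; apply: phom_id. Qed.

Lemma piso_sym P Q : piso P Q -> piso Q P.
Proof.
move=> [S [S' [T [T' [e1 e2 e3 e4 h]]]]].
by exists S', S, T', T; split => //; apply: phom_inv h _ _.
Qed.

Lemma piso_trans Q P Z : piso P Q -> piso Q Z -> piso P Z.
Proof.
move=> [S1 [S1' [T1 [T1' [e1 e2 e3 e4 h1]]]]] [S2 [S2' [T2 [T2' [f1 f2 f3 f4 h2]]]]].
exists (S2 *m S1), (S1' *m S2'), (T2 *m T1), (T1' *m T2'); split.
- by rewrite mulmxA -(mulmxA S2) e1 mulmx1.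
- by rewrite mulmxA -(mulmxA S1') f2 mulmx1.
- by rewrite mulmxA -(mulmxA T2) e3 mulmx1.
- by rewrite mulmxA -(mulmxA T1') f4 mulmx1.
- exact: phom_comp h1 h2.
Qed.

Lemma psummand_iso P Q : piso P Q -> psummand P Q.
Proof.
move=> [S [S' [T [T' [e1 e2 e3 e4 h]]]]]; exists S, S', T, T'; split => //.
exact: phom_inv h _ _.
Qed.

Lemma psummand_trans Q P Z : psummand P Q -> psummand Q Z -> psummand P Z.
Proof.
move=> [S1 [S1' [T1 [T1' [e2 e4 h1 h1']]]]] [S2 [S2' [T2 [T2' [f2 f4 h2 h2']]]]].
exists (S2 *m S1), (S1' *m S2'), (T2 *m T1), (T1' *m T2'); split.
- by rewrite mulmxA -(mulmxA S1') f2 mulmx1.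
- by rewrite mulmxA -(mulmxA T1') f4 mulmx1.
- exact: phom_comp h1 h2.
- exact: phom_comp h2' h1'.
Qed.

Lemma psummand_addl P Q : psummand P (padd P Q).
Proof.
exists (col_mx 1%:M 0), (row_mx 1%:M 0), (col_mx 1%:M 0), (row_mx 1%:M 0); split.
- by rewrite mul_row_col mulmx1 mulmx0 addr0.
- by rewrite mul_row_col mulmx1 mulmx0 addr0.
- by split; rewrite /= mul_col_mx mul_block_col !mul0mx !mulmx0 mulmx1 mul1mx !addr0.
- by split; rewrite /= mul_mx_row mul_row_block !mul0mx !mulmx0 mulmx1 mul1mx !addr0.
Qed.

Lemma psummand_addr P Q : psummand Q (padd P Q).
Proof.
exists (col_mx 0 1%:M), (row_mx 0 1%:M), (col_mx 0 1%:M), (row_mx 0 1%:M); split.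
- by rewrite mul_row_col mulmx1 mulmx0 add0r.
- by rewrite mul_row_col mulmx1 mulmx0 add0r.
- by split; rewrite /= mul_col_mx mul_block_col !mul0mx !mulmx0 mulmx1 mul1mx !add0r.
- by split; rewrite /= mul_mx_row mul_row_block !mul0mx !mulmx0 mulmx1 mul1mx !add0r.
Qed.

Lemma phom_add P Q P' Q' S1 T1 S2 T2 : @phom P P' S1 T1 -> @phom Q Q' S2 T2 ->
  @phom (padd P Q) (padd P' Q') (block_mx S1 0 0 S2) (block_mx T1 0 0 T2).
Proof.
move=> [e1 a1] [e2 a2].
by split; rewrite /= !mulmx_block !mul0mx !mulmx0 !addr0 !add0r ?e1 ?e2 ?a1 ?a2.
Qed.

Lemma diag_block1 m n m' n' (S : 'M[F]_(m, n)) S' (T : 'M[F]_(m', n')) T' :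
  S *m S' = 1%:M -> T *m T' = 1%:M ->
  block_mx S 0 0 T *m block_mx S' 0 0 T' = 1%:M.
Proof.
move=> e1 e2; rewrite mulmx_block !mul0mx !mulmx0 !addr0 !add0r e1 e2.
by rewrite -scalar_mx_block.
Qed.

Lemma piso_add P Q P' Q' : piso P P' -> piso Q Q' -> piso (padd P Q) (padd P' Q').
Proof.
move=> [S1 [S1' [T1 [T1' [e1 e2 e3 e4 h1]]]]] [S2 [S2' [T2 [T2' [f1 f2 f3 f4 h2]]]]].
exists (block_mx S1 0 0 S2), (block_mx S1' 0 0 S2').
exists (block_mx T1 0 0 T2), (block_mx T1' 0 0 T2').
by split; try exact: diag_block1; apply: phom_add.
Qed.

Lemma swap_block1 m n :
  block_mx 0 1%:M 1%:M 0 *m (block_mx 0 1%:M 1%:M 0 : 'M[F]_(m + n, n + m)) = 1%:M.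
Proof.
by rewrite mulmx_block !mul0mx !mulmx0 !mulmx1 !addr0 !add0r -scalar_mx_block.
Qed.

Lemma shear_block1 m n (Y : 'M[F]_(m, n)) :
  block_mx 1%:M Y 0 1%:M *m block_mx 1%:M (- Y) 0 1%:M = 1%:M.
Proof.
rewrite mulmx_block !mul0mx !mulmx0 !mulmx1 !mul1mx !addr0 !add0r addNr.
by rewrite -scalar_mx_block.
Qed.

Lemma shear_block1' m n (Y : 'M[F]_(m, n)) :
  block_mx 1%:M (- Y) 0 1%:M *m block_mx 1%:M Y 0 1%:M = 1%:M.
Proof. by rewrite -{2}[Y]opprK shear_block1. Qed.

Lemma piso_addC P Q : piso (padd P Q) (padd Q P).
Proof.
exists (block_mx 0 1%:M 1%:M 0), (block_mx 0 1%:M 1%:M 0).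
exists (block_mx 0 1%:M 1%:M 0), (block_mx 0 1%:M 1%:M 0).
split; try exact: swap_block1.
by split; rewrite /= !mulmx_block !mul0mx !mulmx0 !mulmx1 !mul1mx !addr0 !add0r.
Qed.

(** The permutation matrices of the two bijections give the isomorphism; multiplying by one of them
    reindexes rows ([mulM]) or columns ([Mmul]). *)
Lemma piso_perm m n m' n' (E A : 'M[F]_(m, n)) (E' A' : 'M[F]_(m', n'))
    (f : 'I_m -> 'I_m') (f' : 'I_m' -> 'I_m) (g : 'I_n -> 'I_n') (g' : 'I_n' -> 'I_n) :
  cancel f f' -> cancel f' f -> cancel g g' -> cancel g' g ->
  (forall i j, E i j = E' (f i) (g j)) -> (forall i j, A i j = A' (f i) (g j)) ->
  piso (Pen E A) (Pen E' A').
Proof.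
have mulM p q r (X : 'M[F]_(p, q)) (h : 'I_r -> 'I_p) (h' : 'I_p -> 'I_r) :
    cancel h h' -> cancel h' h ->
    (\matrix_(i, j) (h i == j)%:R : 'M_(r, p)) *m X =
    \matrix_(i, j) X (h i) j.
  move=> hK h'K; apply/matrixP => i j; rewrite !mxE (bigD1 (h i)) //= !mxE eqxx mul1r.
  by rewrite big1 ?addr0 // => k /negPf hk; rewrite !mxE eq_sym hk mul0r.
have Mmul p q r (X : 'M[F]_(p, q)) (h : 'I_q -> 'I_r) (h' : 'I_r -> 'I_q) :
    cancel h h' -> cancel h' h ->
    X *m (\matrix_(i, j) (h i == j)%:R : 'M_(q, r)) =
    \matrix_(i, j) X i (h' j).
  move=> hK h'K; apply/matrixP => i j; rewrite !mxE (bigD1 (h' j)) //= !mxE h'K eqxx mulr1.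
  rewrite big1 ?addr0 // => k hk; rewrite !mxE; case: eqP; rewrite ?mulr0 //.
  by move=> e; rewrite -e hK eqxx in hk.
have inv p q (h : 'I_p -> 'I_q) (h' : 'I_q -> 'I_p) : cancel h h' -> cancel h' h ->
    (\matrix_(i, j) (h i == j)%:R : 'M[F]_(p, q)) *m \matrix_(i, j) (h' i == j)%:R = 1%:M.
  by move=> hK h'K; rewrite (mulM _ _ _ _ _ _ hK) //; apply/matrixP => i j; rewrite !mxE hK.
move=> fK f'K gK g'K eE eA.
exists (\matrix_(i, j) (f' i == j)%:R), (\matrix_(i, j) (f i == j)%:R).
exists (\matrix_(i, j) (g' i == j)%:R), (\matrix_(i, j) (g i == j)%:R).
split; try exact: inv.
split; rewrite /= (mulM _ _ _ _ _ _ f'K) // (Mmul _ _ _ _ _ _ g'K) //.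
  by apply/matrixP => i j; rewrite !mxE eE f'K.
by apply/matrixP => i j; rewrite !mxE eA f'K.
Qed.

Lemma piso_addA P Q Z : piso (padd P (padd Q Z)) (padd (padd P Q) Z).
Proof.
case: P Q Z => [m1 n1 E1 A1] [m2 n2 E2 A2] [m3 n3 E3 A3].
apply: (@piso_perm _ _ _ _ _ _ _ _
   (cast_ord (addnA m1 m2 m3)) (cast_ord (esym (addnA m1 m2 m3)))
   (cast_ord (addnA n1 n2 n3)) (cast_ord (esym (addnA n1 n2 n3)))).
- exact: cast_ordK.
- exact: cast_ordKV.
- exact: cast_ordK.
- exact: cast_ordKV.
- move=> i j /=; have := @block_mxA _ _ _ _ _ _ _ E1 0 0 0 E2 0 0 0 E3.
  by rewrite /= !row_mx0 !col_mx0 => ->; rewrite castmxE !esymK.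
- move=> i j /=; have := @block_mxA _ _ _ _ _ _ _ A1 0 0 0 A2 0 0 0 A3.
  by rewrite /= !row_mx0 !col_mx0 => ->; rewrite castmxE !esymK.
Qed.

Lemma piso_add0 P : piso (padd pzero P) P.
Proof.
case: P => m n E A.
exists (row_mx 0 1%:M), (col_mx 0 1%:M), (row_mx 0 1%:M), (col_mx 0 1%:M).
have id2 p : col_mx (0 : 'M_(0, p)) 1%:M *m row_mx (0 : 'M_(p, 0)) 1%:M = 1%:M :> 'M[F]_(0 + p).
  rewrite mul_col_row !mul0mx mulmx0 mulmx1.
  transitivity (block_mx 1%:M 0 0 1%:M : 'M[F]_(0 + p)); last by rewrite -scalar_mx_block.
  by congr block_mx; apply/matrixP => [[]].
split => //=; try by rewrite mul_row_col mul0mx mulmx1 add0r.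
by split; rewrite /= mul_row_block mul_mx_row !mul0mx !mulmx0 mulmx1 mul1mx !add0r.
Qed.

Lemma piso_padd0 P : piso (padd P pzero) P.
Proof. exact: piso_trans (piso_addC _ _) (piso_add0 _). Qed.

Lemma piso_tr P Q : piso P Q -> piso (ptr P) (ptr Q).
Proof.
move=> [S [S' [T [T' [e1 e2 e3 e4 h]]]]].
have [he ha] := phom_inv h e2 e3.
exists T'^T, T^T, S'^T, S^T; split; rewrite -?trmx_mul ?e1 ?e2 ?e3 ?e4 ?trmx1 //.
by split; rewrite /= -!trmx_mul ?he ?ha.
Qed.

Lemma ptr_add P Q : ptr (padd P Q) = padd (ptr P) (ptr Q).
Proof. by rewrite /ptr /padd /= !tr_block_mx !trmx0. Qed.

Lemma ptrK P : ptr (ptr P) = P.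
Proof. by case: P => m n E A; rewrite /ptr /= !trmxK. Qed.

End Pencils.
Arguments pzero {F}.

(** * Kronecker blocks *)

Section Blocks.
Variable F : fieldType.
Implicit Types (b : kblock F) (s : seq (kblock F)) (P Q D : pen F).

Definition kbE b : 'M[F]_(krows b, kcols b) :=
  match b return 'M[F]_(krows b, kcols b) with
  | KRight eps => \matrix_(i, j) (i == j :> nat)%:R
  | KLeft eta => (\matrix_(i, j) (i == j :> nat)%:R)^T
  | KFinite rho z => 1%:M
  | KInfinite sigma => jordan_block sigma 0
  end.

Definition kbA b : 'M[F]_(krows b, kcols b) :=
  match b return 'M[F]_(krows b, kcols b) with
  | KRight eps => \matrix_(i, j) (i.+1 == j :> nat)%:R
  | KLeft eta => (\matrix_(i, j) (i.+1 == j :> nat)%:R)^T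
  | KFinite rho z => jordan_block rho z
  | KInfinite sigma => 1%:M
  end.

Definition kb b : pen F := Pen (kbE b) (kbA b).

Fixpoint kdE s : 'M[F]_(sumn (map (@krows F) s), sumn (map (@kcols F) s)) :=
  match s with
  | [::] => 0
  | b :: s' => block_mx (kbE b) 0 0 (kdE s')
  end.

Fixpoint kdA s : 'M[F]_(sumn (map (@krows F) s), sumn (map (@kcols F) s)) :=
  match s with
  | [::] => 0
  | b :: s' => block_mx (kbA b) 0 0 (kdA s')
  end.

Definition kpen s : pen F := Pen (kdE s) (kdA s).

Lemma kpen_cat s1 s2 : piso (kpen (s1 ++ s2)) (padd (kpen s1) (kpen s2)).
Proof.
elim: s1 => [|b s1 IH]; first by apply: piso_sym; apply: piso_add0.
apply: piso_trans (piso_add (piso_refl (kb b)) IH) _; exact: piso_addA.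
Qed.

Lemma kpen_summand b s : b \in s -> psummand (kb b) (kpen s).
Proof.
elim: s => // c s IH; rewrite inE => /predU1P[->|/IH h].
  exact: (psummand_addl (kb c) (kpen s)).
exact: psummand_trans h (psummand_addr (kb c) (kpen s)).
Qed.

Definition knonfin b :=
  if b is KFinite _ _ then false else kblock_wf b.

(* The pencils which split over [F] into singular and infinite Kronecker
   blocks and pencils lambda I - A. *)
Inductive kron : pen F -> Prop :=
| kron_block b of knonfin b : kron (kb b)
| kron_fin n (A : 'M[F]_n) : kron (pfin A)
| kron_add P Q of kron P & kron Q : kron (padd P Q)
| kron_iso P Q of kron P & piso P Q : kron Q.

(** Reversing the order of both bases turns a nilpotent Jordan block into its transpose. *)
Lemma tr_jordan_iso n : piso (ptr (kb (@KInfinite F n))) (kb (KInfinite n)).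
Proof.
apply: (@piso_perm _ _ _ _ _ _ _ _ _ (@rev_ord n) (@rev_ord n) (@rev_ord n) (@rev_ord n));
  try exact: rev_ordK.
  move=> i j; rewrite !mxE !mul0rn !add0r; congr (_%:R).
  by congr nat_of_bool; apply/eqP/eqP => /=; have := ltn_ord i; have := ltn_ord j; lia.
by move=> i j; rewrite !mxE (inj_eq rev_ord_inj) eq_sym.
Qed.

Lemma kron_tr P : kron P -> kron (ptr P).
Proof.
elim=> {P} [[e|e|r z|n]|n A|P Q _ hP _ hQ|P Q _ hP hPQ] //.
- move=> _; exact: (@kron_block (KLeft e)).
- by move=> _; have := @kron_block (KRight e) isT; rewrite -[kb _]ptrK.
- move=> hn; apply: kron_iso (kron_block hn) _; apply: piso_sym.
  exact: tr_jordan_iso.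
- by rewrite /ptr /= trmx1; apply: kron_fin.
- by rewrite ptr_add; apply: kron_add.
- exact: kron_iso hP (piso_tr hPQ).
Qed.

(** A matrix with trivial kernel has full column rank, so its rank normal form is an identity above
    zeros; the column factor of that form is absorbed into the row transformation. *)
Lemma full_col m t (B : 'M[F]_(m, t)) : (forall v : 'cV_t, B *m v = 0 -> v = 0) ->
  exists m' (S : 'M_(t + m', m)) (S' : 'M_(m, t + m')),
    [/\ m = (t + m')%N, S *m S' = 1%:M, S' *m S = 1%:M & S *m B = col_mx 1%:M 0].
Proof.
move=> inj; have rB : \rank B = t.
  rewrite -mxrank_tr; apply/eqP; change (row_free B^T); rewrite -kermx_eq0.
  apply/rowV0P => v /sub_kermxP vB.
  by apply: (can_inj (@trmxK _ _ _)); rewrite trmx0; apply: inj; rewrite -[B]trmxK -trmx_mul vB trmx0.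
have le_tm : (t <= m)%N by rewrite -rB rank_leq_row.
have := mulmx_ebase B; have := col_ebase_unit B; have := row_ebase_unit B.
move: (col_ebase B) (row_ebase B); rewrite rB.
case: m B inj rB le_tm => [|m] B inj rB le_tm L R uR uL eB.
  have t0 : t = 0%N by apply/eqP; rewrite -leqn0.
  move: t0 => t0; subst t; exists 0%N, 1%:M, 1%:M; split; rewrite ?mulmx1 //.
  by apply/matrixP => [[]].
move: L uL eB; have [m' em] : exists m', m.+1 = (t + m')%N by exists (m.+1 - t)%N; rewrite subnKC.
move: B inj rB; rewrite em => B inj rB L uL eB; exists m'.
exists (block_mx (invmx R) 0 0 1%:M *m invmx L), (L *m block_mx R 0 0 1%:M).
have dV : block_mx R 0 0 1%:M *m block_mx (invmx R) 0 0 1%:M = 1%:M :> 'M_(t + m').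
  by apply: diag_block1; rewrite ?mulmx1 // mulmxV.
have dV' : block_mx (invmx R) 0 0 1%:M *m block_mx R 0 0 1%:M = 1%:M :> 'M_(t + m').
  by apply: diag_block1; rewrite ?mulmx1 // mulVmx.
split=> //.
- by rewrite mulmxA -(mulmxA _ (invmx L)) mulVmx // mulmx1 dV'.
- by rewrite mulmxA -(mulmxA L) dV mulmx1 mulmxV.
rewrite -eB pid_mx_col !mulmxA -(mulmxA _ (invmx L)) mulVmx // mulmx1.
rewrite mul_block_col !mul0mx !mulmx0 !mulmx1 !addr0 mul_col_mx mul0mx.
by rewrite mulVmx.
Qed.

(* The normal form of a pencil whose leading matrix has a [k]-dimensional
   kernel on which the second matrix is injective. *)
Definition ext k D (C : 'M[F]_(k, pcol D)) : pen F :=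
  Pen (block_mx (0 : 'M_k) C 0 (pE D)) (block_mx 1%:M 0 0 (pA D)).

Lemma ext_iso k D D' (C : 'M_(k, pcol D)) S S' T T' :
  S *m S' = 1%:M -> S' *m S = 1%:M -> T *m T' = 1%:M -> T' *m T = 1%:M ->
  @phom _ D D' S T -> piso (ext C) (@ext k D' (C *m T')).
Proof.
move=> e1 e2 e3 e4 [hE hA].
exists (block_mx 1%:M 0 0 S), (block_mx 1%:M 0 0 S').
exists (block_mx 1%:M 0 0 T), (block_mx 1%:M 0 0 T').
split; try by apply: diag_block1; rewrite ?mulmx1.
split; rewrite /= !mulmx_block !mul0mx !mulmx0 ?mulmx1 ?mul1mx !addr0 !add0r.
  by rewrite hE -mulmxA e4 mulmx1.
by rewrite hA.
Qed.

Lemma ext_rows k k' D (C : 'M_(k, pcol D)) (G : 'M_(k', k)) G' :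
  G *m G' = 1%:M -> G' *m G = 1%:M -> piso (ext C) (@ext k' D (G *m C)).
Proof.
move=> e1 e2.
exists (block_mx G 0 0 1%:M), (block_mx G' 0 0 1%:M).
exists (block_mx G 0 0 1%:M), (block_mx G' 0 0 1%:M).
split; try by apply: diag_block1; rewrite ?mulmx1.
by split; rewrite /= !mulmx_block !mul0mx !mulmx0 ?mulmx1 ?mul1mx !addr0 !add0r.
Qed.

(** Adding [X] times the lower rows to the upper ones also creates a block in the second matrix. A
    column operation based on the identity block clears it, and leaves the first matrix alone
    because the first columns there vanish. *)
Lemma ext_mod k D (C : 'M_(k, pcol D)) (X : 'M_(k, prow D)) :
  piso (ext C) (@ext k D (C + X *m pE D)).
Proof.
exists (block_mx 1%:M X 0 1%:M), (block_mx 1%:M (- X) 0 1%:M).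
exists (block_mx 1%:M (X *m pA D) 0 1%:M), (block_mx 1%:M (- (X *m pA D)) 0 1%:M).
split; try exact: shear_block1; try exact: shear_block1'.
by split; rewrite /= !mulmx_block !mul0mx !mulmx0 ?mulmx1 ?mul1mx !addr0 !add0r.
Qed.

Lemma ext_add k1 k2 D1 D2 (C1 : 'M_(k1, pcol D1)) (C2 : 'M_(k2, pcol D2)) :
  piso (@ext (k1 + k2) (padd D1 D2) (block_mx C1 0 0 C2)) (padd (ext C1) (ext C2)).
Proof.
have V (a b c d : nat) : (block_mx (block_mx 1%:M 0 0 0) (block_mx 0 0 1%:M 0)
   (block_mx 0 1%:M 0 0) (block_mx 0 0 0 1%:M) : 'M_((a + b) + (c + d), _)) *m
   (block_mx (block_mx 1%:M 0 0 0) (block_mx 0 0 1%:M 0)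
   (block_mx 0 1%:M 0 0) (block_mx 0 0 0 1%:M) : 'M_((a + c) + (b + d), _)) = 1%:M :> 'M[F]_(_).
  rewrite !mulmx_block !mul0mx !mulmx0 !mulmx1 !add_block_mx !addr0 !add0r.
  by rewrite !block_mx0 -!scalar_mx_block.
do 4!exists (block_mx (block_mx 1%:M 0 0 0) (block_mx 0 0 1%:M 0)
   (block_mx 0 1%:M 0 0) (block_mx 0 0 0 1%:M)).
split; try exact: V.
split; rewrite /= ?(scalar_mx_block k1 k2) !mulmx_block !mul0mx !mulmx0 ?mulmx1 ?mul1mx.
  by rewrite ?add_block_mx ?addr0 ?add0r ?block_mx0.
by rewrite ?add_block_mx ?addr0 ?add0r ?block_mx0.
Qed.

Lemma ext0_iso D (C : 'M_(0, pcol D)) : piso D (ext C).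
Proof.
apply: piso_trans (piso_sym (piso_add0 D)) _.
exists 1%:M, 1%:M, 1%:M, 1%:M; split; rewrite ?mulmx1 //.
split; rewrite /= !mulmx1 !mul1mx; congr block_mx; apply/matrixP => [[]] //.
Qed.

(** Zero rows of the coupling decouple and become infinite blocks of size one. *)
Lemma ext_pad k k' D (C : 'M_(k, pcol D)) :
  piso (@ext (k + k') D (col_mx C 0)) (padd (ext C) (@Pen F k' k' 0 1%:M)).
Proof.
have V (a b c : nat) : (block_mx (block_mx 1%:M 0 0 0) (col_mx 0 1%:M) (row_mx 0 1%:M) 0 :
    'M[F]_((a + b) + c, (a + c) + b)) *m
  block_mx (block_mx 1%:M 0 0 0) (col_mx 0 1%:M) (row_mx 0 1%:M) 0 = 1%:M.
  rewrite mulmx_block !mulmx0 mul_col_row mulmx_block mul_block_col !mul_row_col !mul_mx_row.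
  rewrite !mul0mx !mulmx0 !mulmx1 !add_block_mx !addr0 !add0r col_mx0 row_mx0.
  by rewrite !addr0 -!scalar_mx_block.
do 4!exists (block_mx (block_mx 1%:M 0 0 0) (col_mx 0 1%:M) (row_mx 0 1%:M) 0).
split; try exact: V.
split; rewrite /= ?(scalar_mx_block k k') !mulmx_block !mul0mx !mulmx0 ?mulmx1 ?mul1mx
  ?mul_row_col ?mul_col_row ?mul_block_col ?mul_row_block ?mul_col_mx ?mul_mx_row
  ?mulmx_block !mul0mx !mulmx0 ?mulmx1 ?mul1mx ?add_block_mx ?add_col_mx ?add_row_mx
  !addr0 !add0r ?col_mx0 ?row_mx0 ?block_mx0 //.
Qed.

Lemma kron_inf1 n : kron (@Pen F n n 0 1%:M).
Proof.
elim: n => [|n IH].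
  suff -> : (0 : 'M[F]_0) = 1%:M by apply: kron_fin.
  by apply/matrixP => [[]].
suff -> : @Pen F n.+1 n.+1 0 1%:M = padd (kb (KInfinite 1)) (@Pen F n n 0 1%:M).
  by apply: kron_add => //; apply: (@kron_block (KInfinite 1)).
rewrite /padd /=; congr Pen; last by rewrite -(scalar_mx_block 1 n).
suff -> : jordan_block 1 (0 : F) = 0 by rewrite -(block_mx0 F 1 n 1 n).
by apply/matrixP => i j; rewrite !ord1 !mxE mul0rn addr0.
Qed.

(* [K] and [C] split off the kernel of the leading matrix of [D]. *)
Definition good D := exists t (C : 'M_(t, pcol D)) K Z,
  [/\ C *m K = 1%:M, K *m C + Z *m pE D = 1%:M, pE D *m K = 0 & kron (ext C)].

Lemma good_inj D Z : Z *m pE D = 1%:M -> kron D -> good D.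
Proof.
move=> ZE kD; exists 0%N, 0, 0, Z; split; rewrite ?mulmx0 ?mul0mx ?add0r //.
  by apply/matrixP => [[]].
exact: kron_iso kD (ext0_iso _).
Qed.

Lemma good_iso D D' : good D -> piso D D' -> good D'.
Proof.
move=> [t [C [K [Z [e1 e2 e3 e4]]]]] [S [S' [T [T' [f1 f2 f3 f4 h]]]]].
have [hE' _] := phom_inv h f2 f3; have [hE _] := h.
exists t, (C *m T'), (T *m K), (T *m Z *m S'); split.
- by rewrite mulmxA -(mulmxA C) f4 mulmx1.
- rewrite -(mulmxA _ S') hE' !mulmxA -mulmxDl -!mulmxA -mulmxDr.
  by rewrite e2 mulmx1.
- by rewrite mulmxA -hE -mulmxA e3 mulmx0.
- exact: kron_iso e4 (ext_iso C f1 f2 f3 f4 h).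
Qed.

Lemma good_add D D' : good D -> good D' -> good (padd D D').
Proof.
move=> [t [C [K [Z [e1 e2 e3 e4]]]]] [t' [C' [K' [Z' [f1 f2 f3 f4]]]]].
exists (t + t')%N, (block_mx C 0 0 C'), (block_mx K 0 0 K'), (block_mx Z 0 0 Z'); split.
- exact: diag_block1.
- rewrite /= !mulmx_block !mul0mx !mulmx0 !addr0 !add0r add_block_mx e2 f2 !addr0.
  by rewrite -scalar_mx_block.
- by rewrite /= !mulmx_block !mul0mx !mulmx0 !addr0 !add0r e3 f3 block_mx0.
- exact: kron_iso (kron_add e4 f4) (piso_sym (ext_add _ _)).
Qed.

(** Since K C' + Z E = 1, the coupling C differs from C K C' by a multiple of the leading matrix,
    which [ext_mod] removes. The injectivity hypothesis makes C K injective, and row operations turn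
    it into an identity above zeros. What remains is the extension by C' provided by [good],
    together with infinite blocks of size one. *)
Lemma good_ext k D (C : 'M_(k, pcol D)) : good D ->
  (forall v : 'cV_(pcol D), C *m v = 0 -> pE D *m v = 0 -> v = 0) -> kron (ext C).
Proof.
move=> [t [C' [K [Z [e1 e2 e3 e4]]]]] inj.
have injK (v : 'cV_t) : C *m K *m v = 0 -> v = 0.
  move=> CKv; rewrite -[v]mul1mx -e1 -mulmxA (inj (K *m v)) ?mulmx0 //.
    by rewrite mulmxA.
  by rewrite mulmxA e3 mul0mx.
have [k' [S [S' [_ s1 s2 sC]]]] := full_col injK.
have h : piso (ext C) (@ext k D (C *m K *m C')).
  suff -> : C *m K *m C' = C + - (C *m Z) *m pE D by apply: ext_mod.
  rewrite mulNmx; apply/esym/(canLR (addrK _)).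
  by rewrite -!mulmxA -mulmxDr e2 mulmx1.
have {}h := piso_trans h (ext_rows _ s1 s2).
rewrite mulmxA sC mul_col_mx mul1mx mul0mx in h.
apply: kron_iso (kron_add e4 (kron_inf1 k')) _; apply: piso_sym.
exact: piso_trans h (ext_pad _ _).
Qed.

End Blocks.

(** * Existence of the Kronecker decomposition *)

Section Existence.
Variable F : fieldType.
Implicit Types (b : kblock F) (s : seq (kblock F)) (P Q D : pen F).

Lemma sum_pred1 n (G : 'I_n -> F) (P : pred 'I_n) (i : 'I_n) : (forall j, P j = (j == i)) ->
  \sum_j (P j)%:R * G j = G i.
Proof.
move=> Pi; rewrite (bigD1 i) //= Pi eqxx mul1r big1 ?addr0 // => j /negPf ji.
by rewrite Pi ji mul0r.
Qed.

Lemma good_left e : good (kb (@KLeft F e)).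
Proof.
apply: (@good_inj _ _ (\matrix_(i, j) (i == j :> nat)%:R)); last exact: kron_block.
apply/matrixP => i j; rewrite !mxE.
rewrite (eq_bigr (fun k : 'I_e.+1 => ((k == i :> nat)%:R * (j == k :> nat)%:R : F))).
  rewrite (@sum_pred1 _ _ _ (widen_ord (leqnSn e) i)) //=.
  by rewrite eq_sym.
by move=> k _; rewrite !mxE [i == k :> nat]eq_sym.
Qed.

(** The kernel of the leading matrix is spanned by the last unit vector, and coupling along it
    produces the right block of index e + 1. *)
Lemma good_right e : good (kb (@KRight F e)).
Proof.
exists 1%N, (\matrix_(i, j) (j == e :> nat)%:R), (\matrix_(i, j) (i == e :> nat)%:R).
exists (\matrix_(i, j) (i == j :> nat)%:R); split.
- apply/matrixP => i j; rewrite /= in i j *; rewrite !ord1 !mxE eqxx.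
  rewrite (eq_bigr (fun k : 'I_e.+1 => ((k == e :> nat)%:R * (k == e :> nat)%:R : F))).
    by rewrite (@sum_pred1 _ _ _ ord_max) //= eqxx.
  by move=> k _; rewrite !mxE.
- apply/matrixP => i j; rewrite /= in i j *; rewrite !mxE big_ord1 !mxE.
  rewrite (eq_bigr (fun k : 'I_e => ((i == k :> nat)%:R * (k == j :> nat)%:R : F))); last first.
    by move=> k _; rewrite !mxE.
  have [ie|ie] := eqVneq (i : nat) e.
    rewrite mul1r big1 ?addr0; last first.
      by move=> k _; rewrite ie; case: eqP; rewrite ?mul0r //; have := ltn_ord k; lia.
    by congr (_%:R); congr nat_of_bool; apply/eqP/eqP => [h|<-//]; apply: val_inj; rewrite /= ie h.
  have lt_ie : (i < e)%N by have := ltn_ord i; move/eqP: ie; lia.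
  by rewrite mul0r add0r (@sum_pred1 _ _ _ (Ordinal lt_ie)) // => k; rewrite eq_sym.
- apply/matrixP => i j; rewrite /= in i j *; rewrite !mxE big1 // => k _; rewrite !mxE.
  have [ik|] := eqVneq (i : nat) k; rewrite ?mul0r // mul1r -ik.
  by have := ltn_ord i; case: eqP => //; lia.
apply: (@kron_iso _ (kb (KRight e.+1))); first exact: kron_block.
(* The reordering is a cyclic shift: the last index goes to the front, the others move up by one. *)
have f1 n (i : 'I_n.+1) : ((if i == n :> nat then 0%N else i.+1) < n.+1)%N.
  by have := ltn_ord i; case: eqP; lia.
have f2 n (i : 'I_n.+1) : ((if i == 0%N :> nat then n else i.-1) < n.+1)%N.
  by have := ltn_ord i; case: eqP; lia.
have fK n (i : 'I_n.+1) : Ordinal (f2 _ (Ordinal (f1 _ i))) = i.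
  by apply: val_inj => /=; case: (eqVneq (nat_of_ord i) n) => [->|] /=; rewrite ?eqxx.
have gK n (i : 'I_n.+1) : Ordinal (f1 _ (Ordinal (f2 _ i))) = i.
  apply: val_inj => /=; case: (eqVneq (nat_of_ord i) 0%N) => [->|] /=; rewrite ?eqxx //.
  by move=> i0; have := ltn_ord i; case: (i.-1 =P n); lia.
apply: (@piso_perm _ e.+1 e.+2 (1 + e) (1 + e.+1) _ _ _ _
   (fun i => Ordinal (f1 _ i)) (fun i => Ordinal (f2 _ i))
   (fun i => Ordinal (f1 _ i)) (fun i => Ordinal (f2 _ i))).
- exact: fK.
- exact: gK.
- exact: fK.
- exact: gK.
- move=> i j; rewrite !mxE; case: splitP => i' /= Ei; rewrite !mxE; case: splitP => j' /= Ej;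
  rewrite ?mxE; have := ltn_ord i'; have := ltn_ord j'; move: Ei Ej; case: ifP => ?; case: ifP => ?; do !case: eqP => //= *; exfalso; simpl in *; lia.
- move=> i j; rewrite !mxE; case: splitP => i' /= Ei; rewrite !mxE; case: splitP => j' /= Ej;
  rewrite ?mxE; have := ltn_ord i'; have := ltn_ord j'; move: Ei Ej;
  rewrite -?val_eqE /=; case: ifP => ?; case: ifP => ?; do !case: eqP => //= *; exfalso; simpl in *; lia.
Qed.

(** Here the kernel is spanned by the first unit vector, and bordering along it gives the nilpotent
    block of the next size with rows and columns already in order. *)
Lemma good_infinite n : (0 < n)%N -> good (kb (@KInfinite F n)).
Proof.
case: n => // n _.
exists 1%N, (\matrix_(i, j) (j == 0%N :> nat)%:R), (\matrix_(i, j) (i == 0%N :> nat)%:R).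
exists (\matrix_(i, j) (j.+1 == i :> nat)%:R); split.
- apply/matrixP => i j; rewrite /= in i j *; rewrite !ord1 !mxE eqxx.
  rewrite (eq_bigr (fun k : 'I_n.+1 => ((k == 0%N :> nat)%:R * (k == 0%N :> nat)%:R : F))).
    by rewrite (@sum_pred1 _ _ _ ord0) //= eqxx.
  by move=> k _; rewrite !mxE.
- apply/matrixP => i j; rewrite /= in i j *; rewrite !mxE big_ord1 !mxE.
  rewrite (eq_bigr (fun k : 'I_n.+1 => ((k.+1 == i :> nat)%:R * (k.+1 == j :> nat)%:R : F))); last first.
    by move=> k _; rewrite !mxE mul0rn add0r.
  have [i0|i0] := eqVneq (i : nat) 0%N.
    rewrite mul1r big1 ?addr0; last by move=> k _; rewrite i0 mul0r.
    by congr (_%:R); congr nat_of_bool; apply/eqP/eqP => [h|<-//]; apply: val_inj; rewrite /= i0 h.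
  have lt_i : (i.-1 < n.+1)%N by have := ltn_ord i; lia.
  rewrite mul0r add0r (@sum_pred1 _ _ _ (Ordinal lt_i)) /=; last first.
    by move=> k; rewrite -val_eqE /=; do !case: eqP => //; move/eqP: i0; lia.
  by rewrite prednK ?lt0n.
- apply/matrixP => i j; rewrite /= in i j *; rewrite !mxE big1 // => k _; rewrite !mxE mul0rn add0r.
  by have [->|] := eqVneq (k : nat) 0%N; rewrite ?mulr0 ?mul0r.
apply: (@kron_iso _ (kb (KInfinite n.+2))); first exact: kron_block.
apply: (@piso_perm _ n.+2 n.+2 (1 + n.+1) (1 + n.+1) _ _ _ _ id id id id) => //.
- move=> i j; rewrite !mxE; case: splitP => i' /= Ei; rewrite !mxE; case: splitP => j' /= Ej;
  have {}Ei : nat_of_ord i = _ := Ei; have {}Ej : nat_of_ord j = _ := Ej;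
  rewrite ?mxE ?mul0rn ?add0r; have := ltn_ord i'; have := ltn_ord j'; move: Ei Ej; do !case: eqP => //= *; exfalso; simpl in *; lia.
- move=> i j; rewrite !mxE; case: splitP => i' /= Ei; rewrite !mxE; case: splitP => j' /= Ej;
  have {}Ei : nat_of_ord i = _ := Ei; have {}Ej : nat_of_ord j = _ := Ej;
  rewrite ?mxE; have := ltn_ord i'; have := ltn_ord j'; move: Ei Ej;
  rewrite -?val_eqE /=; do !case: eqP => //= *; exfalso; simpl in *; lia.
Qed.

Lemma kron_good D : kron D -> good D.
Proof.
elim=> {D} [[e|e|r z|n]|n A|P Q _ hP _ hQ|P Q _ hP hPQ] //.
- by move=> _; apply: good_right.
- by move=> _; apply: good_left.
- by move=> hn; apply: good_infinite.
- exact: (@good_inj _ (pfin A) 1%:M (mulmx1 _) (kron_fin A)).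
- exact: good_add.
- exact: good_iso hP hPQ.
Qed.

Lemma piso_cols m n n' (E A : 'M[F]_(m, n)) (T : 'M_(n', n)) T' :
  T *m T' = 1%:M -> T' *m T = 1%:M -> piso (Pen E A) (Pen (E *m T') (A *m T')).
Proof.
move=> e1 e2; exists 1%:M, 1%:M, T, T'; split; rewrite ?mulmx1 //.
by split; rewrite /= mul1mx -mulmxA e2 mulmx1.
Qed.

Lemma piso_rows m n m' (E A : 'M[F]_(m, n)) (S : 'M_(m', m)) S' :
  S *m S' = 1%:M -> S' *m S = 1%:M -> piso (Pen E A) (Pen (S *m E) (S *m A)).
Proof.
move=> e1 e2; exists S, S', 1%:M, 1%:M; split; rewrite ?mulmx1 //.
by split; rewrite /= mulmx1.
Qed.

(** A basis [K] of the kernel forms a matrix of full column rank; [full_col] completes it to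
    coordinates in which the kernel comes first. *)
Lemma kernel_split m n (E : 'M[F]_(m, n)) :
  exists k n' (T : 'M_(k + n', n)) (T' : 'M_(n, k + n')) (E' : 'M_(m, n')),
    [/\ n = (k + n')%N, T *m T' = 1%:M, T' *m T = 1%:M,
        E *m T' = row_mx 0 E' & forall v : 'cV_n', E' *m v = 0 -> v = 0].
Proof.
pose K := (row_base (kermx E^T))^T.
have injK (v : 'cV_(\rank (kermx E^T))) : K *m v = 0 -> v = 0.
  move=> Kv; apply: (can_inj (@trmxK _ _ _)); rewrite trmx0.
  by apply: (row_free_inj (row_base_free (kermx E^T))); rewrite -[row_base _]trmxK -trmx_mul Kv mul0mx trmx0.
have EK : E *m K = 0.
  apply: (can_inj (@trmxK _ _ _)); rewrite trmx_mul trmx0 trmxK.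
  by apply/sub_kermxP; rewrite eq_row_base.
have kerE (v : 'cV_n) : E *m v = 0 -> exists u, v = K *m u.
  move=> Ev; have : (v^T <= row_base (kermx E^T))%MS.
    by rewrite eq_row_base; apply/sub_kermxP; rewrite -trmx_mul Ev trmx0.
  by case/submxP => u uv; exists u^T; rewrite -[K *m _]trmxK trmx_mul !trmxK -uv trmxK.
have [n' [T [T' [dn t1 t2 TK]]]] := full_col injK.
exists (\rank (kermx E^T)), n', T, T', (rsubmx (E *m T')).
have EL : lsubmx (E *m T') = 0.
  have : E *m T' *m (T *m K) = 0 by rewrite mulmxA -(mulmxA E) t2 mulmx1.
  by rewrite TK -{1}[E *m T']hsubmxK mul_row_col mulmx0 mulmx1 addr0.
have ET : E *m T' = row_mx 0 (rsubmx (E *m T')) by rewrite -EL hsubmxK.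
split=> // v Ev.
have : E *m (T' *m col_mx 0 v) = 0 by rewrite mulmxA ET mul_row_col mul0mx Ev addr0.
case/kerE => u /(congr1 (mulmx T)); rewrite !mulmxA t1 mul1mx TK mul_col_mx mul1mx mul0mx.
by case/eq_col_mx.
Qed.

Lemma col_mx_flat m n (X : 'M[F]_(0, n)) (Y : 'M_(m, n)) : col_mx X Y = Y.
Proof.
apply/matrixP => i j; rewrite mxE; case: splitP => [[]//|k ek].
by congr (Y _ _); apply: val_inj.
Qed.

(** Inductive step at a kernel vector of the leading matrix: either a zero column splits off, or the
    second matrix is injective on the whole kernel and the pencil takes the form [ext] over a
    smaller pencil. *)
Lemma kron_kernel m n (E A : 'M[F]_(m, n)) (v : 'cV_n) :
  (forall P, (prow P + pcol P < m + n)%N -> kron P) ->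
  v != 0 -> E *m v = 0 -> kron (Pen E A).
Proof.
move=> IH v0 Ev.
have [[u /eqP u0 [Eu Au]]|nocommon] :=
  pselect (exists2 u : 'cV_n, u <> 0 & E *m u = 0 /\ A *m u = 0).
(* A common kernel vector, taken as first basis vector, gives a zero column, which is the block
   [KRight 0]. *)
- have inju (w : 'cV_1) : u *m w = 0 -> w = 0.
    rewrite [w]mx11_scalar mul_mx_scalar => /eqP; rewrite scaler_eq0 (negPf u0) orbF.
    by move/eqP ->; rewrite raddf0.
  have [n' [T [T' [dn t1 t2 Tu]]]] := full_col inju.
  have L (X : 'M_(m, n)) : X *m u = 0 -> X *m T' = row_mx 0 (rsubmx (X *m T')).
    move=> Xu; rewrite -[LHS]hsubmxK; congr row_mx.
    have : X *m T' *m (T *m u) = 0 by rewrite mulmxA -(mulmxA X) t2 mulmx1.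
    by rewrite Tu -{1}[X *m T']hsubmxK mul_row_col mulmx0 mulmx1 addr0.
  have kP : kron (Pen (rsubmx (E *m T')) (rsubmx (A *m T'))).
    by apply: IH; rewrite /= ltn_add2l dn.
  have k0 := @kron_block _ (@KRight F 0) isT.
  apply: kron_iso (kron_add k0 kP) _; apply: piso_sym.
  apply: piso_trans (piso_cols E A t1 t2) _; rewrite (L _ Eu) (L _ Au).
  exists 1%:M, 1%:M, 1%:M, 1%:M; split; rewrite ?mulmx1 //.
  by split; rewrite /= mul1mx mulmx1 block_mxEh !col_mx_flat row_mxKr.
have [k [n' [T [T' [E' [dn t1 t2 ET injE']]]]]] := kernel_split E.
have k_gt0 : (0 < k)%N.
  case: k => // in T T' E' dn t1 t2 ET injE' *; case/eqP: v0.
  rewrite -[v]mul1mx -t2 -mulmxA.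
  have : E' *m dsubmx (T *m v) = 0.
    have : E *m T' *m (T *m v) = 0 by rewrite mulmxA -(mulmxA E) t2 mulmx1.
    by rewrite ET -{1}[T *m v]vsubmxK mul_row_col mul0mx add0r.
  move/injE' => dv; rewrite -[T *m v]vsubmxK dv.
  suff -> : usubmx (T *m v) = 0 by rewrite col_mx0 mulmx0.
  by apply/matrixP => [[]].
have injA0 (w : 'cV_k) : lsubmx (A *m T') *m w = 0 -> w = 0.
  move=> Aw; have cw (X : 'M_(m, n)) : X *m (T' *m col_mx w 0) = lsubmx (X *m T') *m w.
    by rewrite mulmxA -{1}[X *m T']hsubmxK mul_row_col mulmx0 addr0.
  case: (pselect (T' *m col_mx w 0 = 0)) => [Tw|Tw].
    have : T *m (T' *m col_mx w 0) = 0 by rewrite Tw mulmx0.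
    by rewrite mulmxA t1 mul1mx => /(congr1 usubmx); rewrite col_mxKu linear0.
  case: nocommon; exists (T' *m col_mx w 0) => //.
  by rewrite !cw Aw ET row_mxKl mul0mx.
(* Row operations bring the second matrix, restricted to the kernel of [E], to an identity above
   zeros. *)
have [m' [S [S' [dm s1 s2 SA]]]] := full_col injA0.
apply: kron_iso (_ : kron (@ext F k (Pen (dsubmx (S *m E')) (dsubmx (S *m rsubmx (A *m T'))))
   (usubmx (S *m E')))) _.
  apply: good_ext.
    by apply: kron_good; apply: IH; rewrite /= dm dn; lia.
  move=> w /= uw dw; apply: injE'; rewrite -[_ *m w]mul1mx -s2 -mulmxA (mulmxA S).
  by rewrite -[S *m E']vsubmxK mul_col_mx uw dw col_mx0 mulmx0.
apply: piso_sym; apply: piso_trans (piso_cols E A t1 t2) _.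
apply: piso_trans (piso_rows _ _ s1 s2) _.
rewrite ET -[A *m T']hsubmxK !mul_mx_row SA mulmx0 hsubmxK.
set X := S *m E'; set Y := S *m rsubmx _.
rewrite -[X]vsubmxK -[Y]vsubmxK -(@col_mx0 F k m' k) -!block_mxEh.
(* The columns of the kernel clear the block to the right of the identity; they are zero in the
   leading matrix, which therefore does not change. *)
apply: piso_trans (piso_cols _ _ (shear_block1 (usubmx Y)) (shear_block1' (usubmx Y))) _.
rewrite !mulmx_block !mul0mx !mulmx0 ?mulmx1 ?mul1mx !addr0 !add0r addNr !col_mxKu !col_mxKd.
exact: piso_refl.
Qed.

(** Induction on the number of rows plus columns. A kernel vector of [E] is handled by
    [kron_kernel], one of its transpose by transposing the pencil. If there is neither, [E] is
    square and invertible, and multiplying by its inverse leaves a pencil lambda I - A. *)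
Theorem kron_all P : kron P.
Proof.
have [N] := ubnP (prow P + pcol P); elim: N P => // N IH P lePN.
have {}IH Q : (prow Q + pcol Q < prow P + pcol P)%N -> kron Q.
  by move=> lt; apply: IH; apply: leq_trans lt _.
case: P lePN IH => m n E A /= _ IH.
have [[v /eqP v0 Ev]|injE] := pselect (exists2 v : 'cV_n, v <> 0 & E *m v = 0).
  exact: kron_kernel IH v0 Ev.
have [[v /eqP v0 Ev]|injET] := pselect (exists2 v : 'cV_m, v <> 0 & E^T *m v = 0).
  rewrite -[Pen E A]ptrK; apply: kron_tr; apply: kron_kernel v0 Ev.
  by move=> Q; rewrite (addnC n); apply: IH.
have free p q (B : 'M[F]_(p, q)) : ~ (exists2 v : 'cV_p, v <> 0 & B^T *m v = 0) -> row_free B.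
  move=> injB; rewrite -kermx_eq0; apply/rowV0P => v /sub_kermxP vB.
  apply/eqP/negP => /negP v0; apply: injB; exists v^T; last by rewrite -trmx_mul vB trmx0.
  by apply/eqP; rewrite -(inj_eq (can_inj (@trmxK _ _ _))) trmxK trmx0.
have fE := free _ _ _ injET.
have fET : row_free E^T by apply: free; rewrite trmxK.
have emn : m = n by rewrite -(eqP fE) -mxrank_tr (eqP fET).
subst m; rewrite row_free_unit in fE.
apply: kron_iso (kron_fin (invmx E *m A)) _; apply: piso_sym.
by have := piso_rows E A (mulVmx fE) (mulmxV fE); rewrite mulVmx.
Qed.

Lemma pfin_add n1 n2 (A1 : 'M[F]_n1) (A2 : 'M_n2) :
  padd (pfin A1) (pfin A2) = pfin (block_mx A1 0 0 A2).
Proof. by rewrite /pfin /padd /= -scalar_mx_block. Qed.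

Lemma padd4 P1 P2 Q1 Q2 :
  piso (padd (padd P1 P2) (padd Q1 Q2)) (padd (padd P1 Q1) (padd P2 Q2)).
Proof.
apply: piso_trans (piso_sym (piso_addA _ _ _)) _.
apply: piso_trans _ (piso_addA _ _ _); apply: piso_add (piso_refl _) _.
apply: piso_trans (piso_addA _ _ _) _.
apply: piso_trans _ (piso_sym (piso_addA _ _ _)); apply: piso_add _ (piso_refl _).
exact: piso_addC.
Qed.

Theorem rational_kronecker P : exists s r (B : 'M[F]_r),
  all (@knonfin F) s /\ piso P (padd (kpen s) (pfin B)).
Proof.
have p0 : pfin (0 : 'M[F]_0) = pzero by congr Pen; apply/matrixP => [[]].
elim: (kron_all P) => {P} [b hb|n A|P Q _ [s1 [r1 [B1 [h1 e1]]]] _ [s2 [r2 [B2 [h2 e2]]]]|P Q _ [s [r [B [h e]]]] ePQ].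
- exists [:: b], 0%N, 0; split; first by rewrite /= hb.
  rewrite p0; apply: piso_sym; apply: piso_trans (piso_padd0 _) _.
  exact: (piso_padd0 (kb b)).
- by exists [::], n, A; split => //; apply: piso_sym; apply: piso_add0.
- exists (s1 ++ s2), (r1 + r2)%N, (block_mx B1 0 0 B2); split.
    by rewrite all_cat h1.
  rewrite -pfin_add; apply: piso_trans (piso_add e1 e2) _.
  apply: piso_trans (padd4 _ _ _ _) _; apply: piso_add (piso_refl _).
  exact: piso_sym (kpen_cat _ _).
- by exists s, r, B; split => //; apply: piso_trans (piso_sym ePQ) e.
Qed.

End Existence.

(** * Jordan forms and complete Kronecker forms *)

Section Jordan.
Variable F : fieldType.
Implicit Types (b : kblock F) (s : seq (kblock F)) (P Q : pen F).

Lemma piso_pcol P Q : piso P Q -> pcol P = pcol Q.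
Proof.
move=> [S [S' [T [T' [_ _ e3 e4 _]]]]].
by apply/eqP; rewrite eqn_leq (mulmx1_min e3) (mulmx1_min e4).
Qed.

Lemma piso_prow P Q : piso P Q -> prow P = prow Q.
Proof.
move=> [S [S' [T [T' [e1 e2 _ _ _]]]]].
by apply/eqP; rewrite eqn_leq (mulmx1_min e1) (mulmx1_min e2).
Qed.

Lemma unitmx_inj n (A : 'M[F]_n) : (forall v : 'cV_n, A *m v = 0 -> v = 0) -> A \in unitmx.
Proof.
move=> inj; rewrite -unitmx_tr -row_free_unit -kermx_eq0; apply/rowV0P => v /sub_kermxP vA.
apply: (can_inj (@trmxK _ _ _)); rewrite trmx0; apply: inj.
by rewrite -[A]trmxK -trmx_mul vA trmx0.
Qed.

(* The substitution which sends the eigenvalue infinity to [z]. *)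
Definition pinvert (z : F) P := Pen (pA P) (pE P + z *: pA P).

Lemma pinvert_iso z P Q : piso P Q -> piso (pinvert z P) (pinvert z Q).
Proof.
move=> [S [S' [T [T' [e1 e2 e3 e4 [hE hA]]]]]]; exists S, S', T, T'; split => //.
split=> //=.
by rewrite mulmxDr mulmxDl hE -scalemxAr -scalemxAl hA.
Qed.

Lemma pinvert_add z P Q : pinvert z (padd P Q) = padd (pinvert z P) (pinvert z Q).
Proof. by rewrite /pinvert /padd /= scale_block_mx add_block_mx !scaler0 !addr0. Qed.

Lemma pinvert_infinite z n : pinvert z (kb (KInfinite n)) = kb (KFinite n z).
Proof.
congr Pen; apply/matrixP => i j; rewrite !mxE mul0rn add0r addrC; congr (_ + _).
by case: eqP; rewrite ?mulr1 ?mulr0.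
Qed.

Definition kinfinite b := if b is KInfinite n then (0 < n)%N else false.
Definition kfinite b := if b is KFinite n _ then (0 < n)%N else false.

Lemma pinvert_kpen z s : all kinfinite s -> exists2 s', all kfinite s' &
  piso (pinvert z (kpen s)) (kpen s').
Proof.
elim: s => [_|b s IH /= /andP[hb /IH [s' hs' e]]].
  by exists [::] => //; rewrite /pinvert /= scaler0 addr0; apply: piso_refl.
case: b hb => // n /= n0; exists (KFinite n z :: s'); first by rewrite /= n0.
have -> : kpen (KInfinite n :: s) = padd (kb (KInfinite n)) (kpen s) by [].
rewrite pinvert_add pinvert_infinite.
exact: (piso_add (piso_refl (kb (KFinite n z))) e).
Qed.

(** The inverse is [T' *m S]. This serves to exclude rectangular blocks from a pencil whose second
    matrix is the identity. *)
Lemma summand_id n (E : 'M[F]_n) Q : psummand Q (Pen E 1%:M) ->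
  exists X : 'M_(pcol Q, prow Q), X *m pA Q = 1%:M /\ pA Q *m X = 1%:M.
Proof.
move=> [S [S' [T [T' [eS eT [_ hA] [_ hA']]]]]]; exists (T' *m S); split.
  by rewrite -mulmxA hA /= mul1mx eT.
by rewrite mulmxA -hA' /= mulmx1 eS.
Qed.

(** Induction on the size. For an eigenvalue [z] the pencil with matrices [A - z%:M] and 1 splits
    into infinite blocks and a finite rest. Undoing the substitution turns the infinite blocks into
    Jordan blocks for [z], and the rest is smaller because [A - z%:M] is singular. *)
Theorem jordan_form n (A : 'M[F]_n) :
  (forall m (M : 'M[F]_m.+1), exists z, M - z%:M \notin unitmx) ->
  exists2 s, all kfinite s & piso (pfin A) (kpen s).
Proof.
move=> eigen; have [N] := ubnP n; elim: N n A => // N IH n A.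
case: n A => [|n] A leN.
  exists [::] => //; suff -> : pfin A = kpen [::] by apply: piso_refl.
  by congr Pen; apply/matrixP => [[]].
have [z hz] := eigen _ A.
have [s [r [B [hs e]]]] := rational_kronecker (Pen (A - z%:M) 1%:M).
have summ := psummand_iso (piso_sym e).
(* The second matrix of each block is invertible, hence square, so only infinite blocks occur. *)
have infs : all kinfinite s.
  apply/allP => b bs; have := allP hs b bs.
  have [X [e1 e2]] := summand_id (psummand_trans (kpen_summand bs) 
    (psummand_trans (psummand_addl _ (pfin B)) summ)).
  case: b X e1 e2 {bs} => //= ? X /mulmx1_min h1 /mulmx1_min h2 _; lia.
have [X [XB BX]] := summand_id (psummand_trans (psummand_addr (kpen s) _) summ).
have [s1 hs1 e1] := pinvert_kpen z infs.
have rn : (r < n.+1)%N.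
  rewrite (piso_pcol e : n.+1 = _).
  case: s hs infs e {summ e1} => [|b s] hs infs e.
    (* Without infinite blocks the leading matrix [A - z%:M] would be equivalent to the identity. *)
    case/negP: hz; apply: unitmx_inj => v Av.
    have [S [S' [T [T' [_ _ _ f4 [hE hA]]]]]] := piso_trans e (piso_add0 _).
    rewrite -[v]mul1mx -f4 -mulmxA -[T]mul1mx -hE /= -(mulmxA S) Av.
    by rewrite !mulmx0.
  by case: b hs infs e => //= m _ /andP[m0 _] _; lia.
(* After the substitution the rest has the matrices B and 1 + z B; multiplying by the inverse [X] of
   B makes its leading matrix the identity again. *)
have [s2 hs2 e2] := IH _ (X *m (1%:M + z *: B)) (leq_trans rn leN).
exists (s1 ++ s2); first by rewrite all_cat hs1.
apply: piso_trans _ (piso_sym (kpen_cat _ _)).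
apply: piso_trans _ (piso_add e1 e2).
have -> : pfin A = pinvert z (Pen (A - z%:M) 1%:M).
  by congr Pen; rewrite scalemx1 subrK.
apply: piso_trans (pinvert_iso z e) _; rewrite pinvert_add.
apply: piso_add (piso_refl _) _.
by have := piso_rows B (1%:M + z *: B) XB BX; rewrite XB.
Qed.

Theorem kronecker_form_exists P :
  (forall m (M : 'M[F]_m.+1), exists z, M - z%:M \notin unitmx) ->
  exists2 s, all (@kblock_wf F) s & piso P (kpen s).
Proof.
move=> eigen; have [s [r [B [hs e]]]] := rational_kronecker P.
have [s' hs' e'] := jordan_form B eigen.
exists (s ++ s').
  rewrite all_cat; apply/andP; split; apply/allP => b.
    by move/(allP hs); case: b.
  by move/(allP hs'); case: b.
apply: piso_trans e _; apply: piso_trans _ (piso_sym (kpen_cat _ _)).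
exact: piso_add (piso_refl _) e'.
Qed.

End Jordan.

(** * Hermitian matrices over the ground field *)

Section GroundField.
Variables (R : realType) (k : ground).
Local Notation F := (ground_field R k).
Local Notation cj := (@ground_conj R k).

Lemma ground_conj_zmod : zmod_morphism cj.
Proof. by rewrite /ground_conj; case: k => // x y; rewrite rmorphB. Qed.

Lemma ground_conj_monoid : monoid_morphism cj.
Proof. by rewrite /ground_conj; case: k => //; split => [|x y]; rewrite ?rmorph1 ?rmorphM. Qed.

HB.instance Definition _ := GRing.isZmodMorphism.Build F F cj ground_conj_zmod.
HB.instance Definition _ := GRing.isMonoidMorphism.Build F F cj ground_conj_monoid.

Lemma gconjK : involutive cj.
Proof. by rewrite /ground_conj; case: k => // x; rewrite conjcK. Qed.

Lemma gconj_ge0 (x : F) : 0 <= x -> cj x = x.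
Proof.
rewrite /ground_conj; move: x; case: k => //= -[a b].
by rewrite lecE /= => /andP[/eqP -> _]; rewrite oppr0.
Qed.

Lemma gconjM_ge0 (x : F) : 0 <= cj x * x.
Proof.
rewrite /ground_conj; move: x; case: k => /= [x|x]; first by rewrite -expr2 sqr_ge0.
by rewrite mulrC -sqr_normc exprn_ge0.
Qed.

Lemma gconjM_eq0 (x : F) : cj x * x = 0 -> x = 0.
Proof.
move/eqP; rewrite mulf_eq0 => /orP[|]/eqP // cx.
by rewrite -[x]gconjK cx rmorph0.
Qed.

Lemma adjmxK m n (A : 'M[F]_(m, n)) : adjmx (adjmx A) = A.
Proof. by apply/matrixP => i j; rewrite !mxE gconjK. Qed.

Lemma adjmxM m n p (A : 'M[F]_(m, n)) (B : 'M_(n, p)) :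
  adjmx (A *m B) = adjmx B *m adjmx A.
Proof. by rewrite /adjmx map_mxM trmx_mul. Qed.

Lemma adjmxD m n (A B : 'M[F]_(m, n)) : adjmx (A + B) = adjmx A + adjmx B.
Proof. by rewrite /adjmx map_mxD raddfD. Qed.

Lemma adjmxN m n (A : 'M[F]_(m, n)) : adjmx (- A) = - adjmx A.
Proof. by rewrite /adjmx map_mxN raddfN. Qed.

Lemma adjmxB m n (A B : 'M[F]_(m, n)) : adjmx (A - B) = adjmx A - adjmx B.
Proof. by rewrite adjmxD adjmxN. Qed.

Lemma adjmxZ m n a (A : 'M[F]_(m, n)) : adjmx (a *: A) = cj a *: adjmx A.
Proof. by rewrite /adjmx map_mxZ linearZ. Qed.

Lemma adjmx0 m n : adjmx (0 : 'M[F]_(m, n)) = 0.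
Proof. by rewrite /adjmx map_mx0 trmx0. Qed.

Lemma adjmx_scalar n a : adjmx (a%:M : 'M[F]_n) = (cj a)%:M.
Proof. by rewrite /adjmx map_scalar_mx tr_scalar_mx. Qed.

Lemma adjmx1 n : adjmx (1%:M : 'M[F]_n) = 1%:M.
Proof. by rewrite adjmx_scalar rmorph1. Qed.

Lemma adjmx_block m1 m2 n1 n2 (A : 'M[F]_(m1, n1)) B C (D : 'M_(m2, n2)) :
  adjmx (block_mx A B C D) = block_mx (adjmx A) (adjmx C) (adjmx B) (adjmx D).
Proof. by rewrite /adjmx map_block_mx tr_block_mx. Qed.

Lemma adjmx_col m1 m2 n (A : 'M[F]_(m1, n)) (B : 'M_(m2, n)) :
  adjmx (col_mx A B) = row_mx (adjmx A) (adjmx B).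
Proof. by rewrite /adjmx map_col_mx tr_col_mx. Qed.

Lemma adjmx_unit n (A : 'M[F]_n) : (adjmx A \in unitmx) = (A \in unitmx).
Proof. by rewrite /adjmx unitmx_tr map_unitmx. Qed.

Lemma gram_ge0 n (x : 'cV[F]_n) : 0 <= (adjmx x *m x) 0 0.
Proof. by rewrite !mxE; apply: sumr_ge0 => i _; rewrite !mxE gconjM_ge0. Qed.

Lemma gram_eq0 m n (X : 'M[F]_(m, n)) : adjmx X *m X = 0 -> X = 0.
Proof.
move=> X0; apply/matrixP => i j; have /matrixP /(_ j j) := X0; rewrite !mxE.
move/eqP; rewrite psumr_eq0 => [/allP /(_ i (mem_index_enum _)) /eqP /=|l _]; rewrite !mxE.
  exact: gconjM_eq0.
exact: gconjM_ge0.
Qed.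

(** These are exactly the matrices J - R with J skew-Hermitian and R positive semidefinite, as
    [dissip_split] and [split_dissip] show. *)
Definition dissip n (M : 'M[F]_n) := psdmx (- (M + adjmx M)).

Lemma psd_adj n (M : 'M[F]_n) : psdmx M -> adjmx M = M. Proof. by case. Qed.

(** Positivity is tested at x - s y with y = M x. With a = y^* y and b = y^* M y the form there
    equals s (s b - 2 a); the choice s = a / (b + 1) gives s b <= a, so the value is negative unless
    a = 0. The summand 1 keeps the denominator positive. *)
Lemma psd_ker n (M : 'M[F]_n) (x : 'cV_n) : psdmx M -> adjmx x *m M *m x = 0 -> M *m x = 0.
Proof.
move=> [hM pM] xMx; pose y := M *m x; apply: gram_eq0; rewrite -/y.
have xM : adjmx x *m M = adjmx y by rewrite adjmxM hM.
set a := (adjmx y *m y) 0 0; pose b := (adjmx y *m M *m y) 0 0.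
have a0 : 0 <= a by apply: gram_ge0.
have b0 : 0 <= b by apply: pM.
have b1 : 0 < b + 1 by rewrite ltr_pwDr.
pose s := a / (b + 1); have s0 : 0 <= s by rewrite divr_ge0 // ltW.
have q : (adjmx (x - s *: y) *m M *m (x - s *: y)) 0 0 = s * (s * b - a *+ 2).
  rewrite adjmxB adjmxZ gconj_ge0 // mulmxBr !mulmxBl xMx xM.
  rewrite -!scalemxAr -!scalemxAl -[adjmx y *m M *m x]mulmxA -/y !mxE.
  by rewrite /a /b !mxE; ring.
have sb : s * b <= a.
  by rewrite /s mulrAC ler_pdivrMr // ler_wpM2l // lerDl.
suff a00 : a = 0 by apply/matrixP => i j; rewrite !ord1 [RHS]mxE.
apply/eqP; apply/negPn/negP => an0; have ap : 0 < a by rewrite lt_def an0.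
have sp : 0 < s by rewrite divr_gt0.
have := pM (x - s *: y); rewrite q pmulr_rge0 // subr_ge0 => /le_trans /(_ sb).
by rewrite mulr2n gerDl (lt_geF ap).
Qed.

Lemma psd0 n : psdmx (0 : 'M[F]_n).
Proof. by split; rewrite ?adjmx0 // => x; rewrite mulmx0 mul0mx mxE. Qed.

Lemma psdD n (A B : 'M[F]_n) : psdmx A -> psdmx B -> psdmx (A + B).
Proof.
move=> [hA pA] [hB pB]; split; rewrite ?adjmxD ?hA ?hB // => x.
by rewrite mulmxDr mulmxDl mxE addr_ge0.
Qed.

Lemma psdZ n a (A : 'M[F]_n) : 0 <= a -> psdmx A -> psdmx (a *: A).
Proof.
move=> a0 [hA pA]; split; rewrite ?adjmxZ ?gconj_ge0 ?hA // => x.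
by rewrite -scalemxAr -scalemxAl mxE mulr_ge0.
Qed.

Lemma psd_congr m n (M : 'M[F]_n) (X : 'M_(n, m)) : psdmx M -> psdmx (adjmx X *m M *m X).
Proof.
move=> [hM pM]; split; first by rewrite !adjmxM adjmxK hM !mulmxA.
by move=> x; have := pM (X *m x); rewrite adjmxM !mulmxA.
Qed.

Lemma psd1 n : psdmx (1%:M : 'M[F]_n).
Proof. by split; rewrite ?adjmx1 // => x; rewrite mulmx1 gram_ge0. Qed.

Lemma psd_gram m n (X : 'M[F]_(m, n)) : psdmx (adjmx X *m X).
Proof. by rewrite -[adjmx X]mulmx1; apply: psd_congr; apply: psd1. Qed.

Lemma psd_block m n (A : 'M[F]_m) (B : 'M[F]_n) :
  psdmx A -> psdmx B -> psdmx (block_mx A 0 0 B).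
Proof.
move=> [hA pA] [hB pB]; split; first by rewrite adjmx_block hA hB !adjmx0.
move=> x; rewrite -[x]vsubmxK adjmx_col mul_row_block mul_row_col !mulmx0 add0r addr0 mxE.
by rewrite addr_ge0.
Qed.

Lemma dissip_congr m n (M : 'M[F]_n) (X : 'M_(n, m)) : dissip M -> dissip (adjmx X *m M *m X).
Proof.
rewrite /dissip => h; have := psd_congr X h; congr psdmx.
by rewrite !adjmxM adjmxK mulmxN mulNmx mulmxDr mulmxDl !mulmxA.
Qed.

Lemma dissip_block m n (A : 'M[F]_m) (B : 'M[F]_n) :
  dissip A -> dissip B -> dissip (block_mx A 0 0 B).
Proof.
move=> hA hB; rewrite /dissip adjmx_block !adjmx0 add_block_mx opp_block_mx !addr0 !oppr0.
exact: psd_block.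
Qed.

Lemma dissip_skew n (A : 'M[F]_n) : adjmx A = - A -> dissip A.
Proof. by rewrite /dissip => ->; rewrite subrr oppr0; apply: psd0. Qed.

(** The Hermitian part of [M] is semidefinite and its form vanishes at [x], so it annihilates [x]
    and [M] acts there like a skew-Hermitian matrix. *)
Lemma dissip_isotropic n (M : 'M[F]_n) (x : 'cV_n) :
  dissip M -> adjmx x *m M *m x = 0 -> adjmx M *m x = - (M *m x).
Proof.
move=> hM xMx; have : (- (M + adjmx M)) *m x = 0.
  apply: psd_ker => //; rewrite mulmxN mulNmx mulmxDr mulmxDl xMx add0r.
  have := congr1 (@adjmx R k 1 1) xMx.
  by rewrite !adjmxM adjmxK adjmx0 mulmxA => ->; rewrite oppr0.
by rewrite mulNmx mulmxDl => /eqP; rewrite oppr_eq0 addr_eq0 => /eqP ->; rewrite opprK.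
Qed.

(** A kernel vector is isotropic, so the adjoint of [M] annihilates it too. *)
Lemma dissip_ker n (M : 'M[F]_n) (x : 'cV_n) : dissip M -> M *m x = 0 -> adjmx x *m M = 0.
Proof.
move=> hM Mx; rewrite -[LHS]adjmxK adjmxM adjmxK dissip_isotropic //.
  by rewrite Mx oppr0 adjmx0.
by rewrite -mulmxA Mx mulmx0.
Qed.

End GroundField.

(** * Dissipative Hamiltonian pencils *)

Section Structured.
Variables (R : realType) (k : ground).
Local Notation F := (ground_field R k).

(* [strict] distinguishes the two parts of the theorem: an invertible [Q] can
   be absorbed by an equivalence. *)
Definition hstruct (strict : bool) n (E A : 'M[F]_n) := exists Q : 'M[F]_n,
  [/\ psdmx (adjmx Q *m E), dissip (adjmx Q *m A),
      forall x : 'cV_n, Q *m x = 0 -> if strict then x = 0 else A *m x = 0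
    & forall x : 'cV_n, E *m x = 0 -> Q *m x = 0 -> x = 0].

(** The matrix [Q] is transported by the adjoint of [S'] on the row side. The two products with [Q]
    then change by the congruence with [T'], which preserves both sign conditions. *)
Lemma hstruct_iso strict n n' (E A : 'M[F]_n) (E' A' : 'M[F]_n') :
  piso (Pen E A) (Pen E' A') -> hstruct strict E A -> hstruct strict E' A'.
Proof.
move=> [S [S' [T [T' [s1 s2 t1 t2 [/= hE hA]]]]]] [Q [psdE disA kerQ kerEQ]].
have injS' v : S' *m v = 0 :> 'cV_n -> v = 0.
  by move=> Sv; rewrite -[v]mul1mx -s1 -mulmxA Sv mulmx0.
have injT v : T' *m v = 0 :> 'cV_n -> v = 0.
  by move=> Sv; rewrite -[v]mul1mx -t1 -mulmxA Sv mulmx0.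
have eE : E' = S *m E *m T' by rewrite hE -mulmxA t1 mulmx1.
have eA : A' = S *m A *m T' by rewrite hA -mulmxA t1 mulmx1.
have injaS (v : 'cV_n) : adjmx S' *m v = 0 -> v = 0.
  move=> /(congr1 (mulmx (adjmx S))); rewrite mulmxA -adjmxM s2 adjmx1 mul1mx => ->.
  by rewrite mulmx0.
have injS (v : 'cV_n) : S *m v = 0 -> v = 0.
  by move=> Sv; rewrite -[v]mul1mx -s2 -mulmxA Sv mulmx0.
have QX X : adjmx (adjmx S' *m Q *m T') *m (S *m X *m T') = adjmx T' *m (adjmx Q *m X) *m T'.
  by rewrite !adjmxM adjmxK !mulmxA -(mulmxA _ S' S) s2 mulmx1.
exists (adjmx S' *m Q *m T'); split.
- by rewrite eE QX; apply: psd_congr.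
- by rewrite eA QX; apply: dissip_congr.
- move=> x; rewrite -!mulmxA => /injaS; move: kerQ; case: (strict) => kerQ /kerQ.
    exact: injT.
  by move=> h; rewrite eA -!mulmxA h mulmx0.
- move=> x; rewrite eE -!mulmxA => /injS h1 /injaS h2; apply: injT; exact: kerEQ.
Qed.

(** * Necessity: chains of vectors in a structured pencil *)

Section Necessity.
Variables (n : nat) (E A Q : 'M[F]_n).
Hypothesis psdE : psdmx (adjmx Q *m E).
Hypothesis disA : dissip (adjmx Q *m A).
Hypothesis kerQ : forall x : 'cV_n, Q *m x = 0 -> A *m x = 0.
Hypothesis kerEQ : forall x : 'cV_n, E *m x = 0 -> Q *m x = 0 -> x = 0.
Implicit Types (x y w : 'cV[F]_n) (l : 'rV[F]_n).

Lemma adj_QE : adjmx E *m Q = adjmx Q *m E.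
Proof. by rewrite -(psd_adj psdE) adjmxM adjmxK. Qed.

(** If E x = - Q x, then x^* Q^* E x = - |Q x|^2 is nonnegative, so both Q x and E x vanish. *)
Lemma addEQ_unit : E + Q \in unitmx.
Proof.
apply: unitmx_inj => x; rewrite mulmxDl => /eqP; rewrite addr_eq0 => /eqP Ex.
have Qx : Q *m x = 0.
  apply: gram_eq0; apply/matrixP => i j; rewrite !ord1 [RHS]mxE.
  apply/eqP; rewrite eq_le gram_ge0 andbT -oppr_ge0.
  have [_ /(_ x)] := psdE; rewrite !mulmxA -[_ *m E *m x]mulmxA Ex mulmxN.
  have mN (M : 'M[F]_1) : (- M) 0 0 = - M 0 0 by rewrite mxE.
  by rewrite adjmxM mN mulmxA.
by apply: kerEQ; rewrite // Ex Qx oppr0.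
Qed.

(* The range of [col_mx E Q] is Lagrangian. *)
Lemma lagrangian w y : adjmx Q *m w = adjmx E *m y ->
  exists x, E *m x = w /\ Q *m x = y.
Proof.
move=> h; pose x := invmx (E + Q) *m (w + y); exists x.
have e : E *m x + Q *m x = w + y by rewrite -mulmxDl mulmxA mulmxV ?addEQ_unit // mul1mx.
(* The adjoint of E + Q annihilates w - E x, because w - E x = - (y - Q x) and Q^* E = E^* Q. *)
have d : w - E *m x = 0.
  have U : adjmx (E + Q) \in unitmx by rewrite adjmx_unit addEQ_unit.
  rewrite -[LHS]mul1mx -(mulVmx U) -mulmxA adjmxD mulmxDl.
  have -> : w - E *m x = - (y - Q *m x).
    by apply/eqP; rewrite -addr_eq0 addrACA -opprD -e subrr.
  rewrite mulmxN mulmxBr !(mulmxA (adjmx E)) adj_QE -h -mulmxA -mulmxBr.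
  have -> : w - E *m x = - (y - Q *m x).
    by apply/eqP; rewrite -addr_eq0 addrACA -opprD -e subrr.
  by rewrite addNr mulmx0.
have Ew : E *m x = w by apply/eqP; rewrite -subr_eq0 -opprB d oppr0.
by split=> //; apply: (addrI (E *m x)); rewrite e Ew.
Qed.

(** The pair formed by 0 and Q x satisfies the condition of [lagrangian]; the resulting x' differs
    from x by an element of ker Q, on which A vanishes. *)
Lemma isotropic_shift x : adjmx Q *m (E *m x) = 0 ->
  exists x', E *m x' = 0 /\ A *m x' = A *m x.
Proof.
move=> QEx; have [|x' [Ex' Qx']] := @lagrangian 0 (Q *m x).
  by rewrite mulmx0 mulmxA adj_QE -mulmxA QEx.
exists x'; split=> //; apply/eqP; rewrite -subr_eq0 -mulmxBr; apply/eqP/kerQ.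
by rewrite mulmxBr Qx' subrr.
Qed.

(** The form x1^* Q^* E x1 equals x1^* Q^* B x2, which vanishes because a kernel vector of the
    dissipative Q^* B is also a left kernel vector. [B] stands for A or for A - z E. *)
Lemma chain_isotropic (B : 'M_n) x1 x2 : dissip (adjmx Q *m B) ->
  adjmx Q *m (B *m x1) = 0 -> B *m x2 = E *m x1 -> adjmx Q *m (E *m x1) = 0.
Proof.
move=> disB QBx1 Bx2; rewrite mulmxA; apply: psd_ker => //.
rewrite -!mulmxA -Bx2 !mulmxA -[_ *m _ *m B]mulmxA.
by rewrite (dissip_ker disB) ?mul0mx // -mulmxA.
Qed.

(** For imaginary z the term z Q^* E is skew-Hermitian. *)
Lemma shift_dissip z : ground_conj z + z = 0 -> dissip (adjmx Q *m (A - z *: E)).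
Proof.
move=> zz; move: disA; rewrite /dissip; congr psdmx; congr (- _).
rewrite mulmxBr adjmxB -scalemxAr adjmxZ (psd_adj psdE) addrACA -opprD -scalerDl.
by rewrite [z + _]addrC zz scale0r subr0.
Qed.

(** This is dissipativity evaluated at an eigenvector. When the form of Q^* E is positive there, it
    forces the real part of z to be at most zero. *)
Lemma eigen_form x z : A *m x = z *: (E *m x) ->
  0 <= - (z + ground_conj z) * (adjmx x *m (adjmx Q *m E) *m x) 0 0.
Proof.
move=> Ax; have [_ /(_ x)] := disA; congr (0 <= _).
have e : adjmx x *m (adjmx Q *m A) *m x = z *: (adjmx x *m (adjmx Q *m E) *m x).
  by rewrite -!mulmxA Ax -!scalemxAr.
have e' : adjmx x *m adjmx (adjmx Q *m A) *m x =
    ground_conj z *: (adjmx x *m (adjmx Q *m E) *m x).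
  have := congr1 (@adjmx R k 1 1) e; rewrite adjmxZ !adjmxM !adjmxK !mulmxA => ->.
  by rewrite -(mulmxA _ (adjmx E)) adj_QE !mulmxA.
rewrite mulmxN mulNmx mulmxDr mulmxDl e e' -scalerDl !mxE.
by rewrite mulNr.
Qed.

(** Shift x to x' with E x' = 0 and A x' = A x. The relation for l gives l A x' = 0, that is z l E x
    = 0. *)
Lemma eigen_nonisotropic x z l l2 : z != 0 -> A *m x = z *: (E *m x) ->
  l *m A = z *: (l *m E) + l2 *m E -> adjmx Q *m (E *m x) = 0 -> l *m E *m x = 0.
Proof.
move=> z0 Ax lA /isotropic_shift [x' [Ex' Ax']].
have := congr1 (mulmx^~ x') lA; rewrite mulmxDl -scalemxAl -!mulmxA Ex' !mulmx0 scaler0 addr0.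
by rewrite Ax' Ax -scalemxAr => /eqP; rewrite scaler_eq0 (negPf z0) => /eqP.
Qed.

(** Two uses of [chain_isotropic] make x1 and then x2 isotropic. Shifting x2 to x' in ker E gives l
    E x1 = l A x2 = l A x' = l2 E x' = 0. *)
Lemma null_chain3 x1 x2 x3 l l2 : A *m x1 = 0 -> A *m x2 = E *m x1 -> A *m x3 = E *m x2 ->
  l *m A = l2 *m E -> l *m E *m x1 = 0.
Proof.
move=> Ax1 Ax2 Ax3 lA.
have h1 : adjmx Q *m (E *m x1) = 0.
  by apply: chain_isotropic disA _ Ax2; rewrite Ax1 mulmx0.
have h2 : adjmx Q *m (E *m x2) = 0.
  by apply: chain_isotropic disA _ Ax3; rewrite Ax2.
have [x' [Ex' Ax']] := isotropic_shift h2.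
by rewrite -mulmxA -Ax2 -Ax' mulmxA lA -mulmxA Ex' mulmx0.
Qed.

(** As E x1 = 0, the vector x1 is isotropic for Q^* A, which therefore acts on it as a skew matrix.
    Hence x2^* Q^* E x2 equals, up to sign, x1^* Q^* A x2 = x1^* Q^* E x3 = 0. Now x2 can be shifted
    to x' in ker E, and l A x1 = l E (x2 - x') = l2 A (x2 - x') = 0. *)
Lemma infinite_chain3 x1 x2 x3 l l2 : E *m x1 = 0 -> E *m x2 = A *m x1 ->
  E *m x3 = A *m x2 -> l *m E = l2 *m A -> l *m A *m x1 = 0.
Proof.
move=> Ex1 Ex2 Ex3 lE.
have x1E : adjmx x1 *m adjmx Q *m E = 0.
  rewrite -mulmxA -[LHS]adjmxK adjmxM adjmxK (psd_adj psdE).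
  by rewrite -mulmxA Ex1 mulmx0 adjmx0.
have iso : adjmx (adjmx Q *m A) *m x1 = - (adjmx Q *m A *m x1).
  apply: dissip_isotropic disA _.
  by rewrite mulmxA -[_ *m A *m x1]mulmxA -Ex2 mulmxA x1E mul0mx.
have h2 : adjmx Q *m (E *m x2) = 0.
  rewrite mulmxA; apply: psd_ker => //.
  have : adjmx x1 *m (adjmx Q *m A) *m x2 = 0.
    by rewrite mulmxA -[_ *m A *m x2]mulmxA -Ex3 mulmxA x1E mul0mx.
  rewrite -[adjmx x1 *m _]adjmxK adjmxM adjmxK iso adjmxN mulNmx -[_ *m A *m x1]mulmxA -Ex2.
  rewrite !adjmxM adjmxK -[_ *m Q]mulmxA adj_QE !mulmxA => /eqP.
  by rewrite oppr_eq0 => /eqP.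
have [x' [Ex' Ax']] := isotropic_shift h2.
have -> : l *m A *m x1 = l *m E *m (x2 - x').
  by rewrite mulmxBr -!mulmxA Ex' Ex2 mulmx0 subr0.
by rewrite lE -mulmxA mulmxBr Ax' subrr mulmx0.
Qed.

(* In bases where [Q] is a coordinate projection [D], the block of [K] that
   [A = K Q] leaves free is chosen to make the off-diagonal part of [K] skew. *)
Lemma dissip_factor : exists2 K : 'M_n, A = K *m Q & dissip K.
Proof.
have := mulmx_ebase Q; have := col_ebase_unit Q; have := row_ebase_unit Q.
move: (col_ebase Q) (row_ebase Q) => L V uV uL.
set D := pid_mx _ => eQ.
have DD : D *m D = D by rewrite pid_mx_id // rank_leq_row.
have aD : adjmx D = D by rewrite /adjmx map_pid_mx tr_pid_mx.
pose B := adjmx L *m A *m invmx V.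
have LV : adjmx L *m adjmx (invmx L) = 1%:M by rewrite -adjmxM mulVmx // adjmx1.
have VL : adjmx (invmx L) *m adjmx L = 1%:M by rewrite -adjmxM mulmxV // adjmx1.
have AB : A = adjmx (invmx L) *m B *m V by rewrite /B !mulmxA VL mul1mx mulmxKV.
have BD : B *m D = B.
  apply/eqP; rewrite -subr_eq0 -{2}[B]mulmx1 -mulmxBr; apply/eqP.
  apply/matrixP => i j; rewrite [RHS]mxE.
  have c (X : 'M[F]_n) : (X i j = (X *m (delta_mx j 0 : 'cV_n)) i 0).
    by rewrite -colE mxE.
  rewrite c; set v := delta_mx _ _.
  rewrite /B -!mulmxA (mulmxA A) -[A *m _ *m _]mulmxA kerQ ?mulmx0 ?mxE //.
  by rewrite -eQ -!mulmxA mulKVmx // (mulmxA D) mulmxBr DD mulmx1 subrr mul0mx mulmx0.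
clearbody B; pose K := B - adjmx B + adjmx B *m D.
exists (adjmx (invmx L) *m K *m invmx L).
  rewrite -eQ !mulmxA mulmxKV // -(mulmxA _ K) mulmxDl mulmxBl -(mulmxA (adjmx B)) DD BD.
  by rewrite subrK -AB.
apply: dissip_congr.
have -> : dissip K = dissip (D *m B).
  congr psdmx; congr (- _); rewrite /K !(adjmxD, adjmxN) !adjmxM adjmxK aD.
  by rewrite addrACA -(opprB B (adjmx B)) subrr add0r addrC.
have -> : D *m B = adjmx (invmx V) *m (adjmx Q *m A) *m invmx V.
  rewrite AB -eQ !adjmxM aD !mulmxA mulmxK // -adjmxM mulmxV // adjmx1 mul1mx.
  by rewrite -(mulmxA D) LV mulmx1.
exact: dissip_congr.
Qed.

(** Write A = K Q with K dissipative. The range property yields x0 with E x0 = K^* l^*, Q x0 = 0 and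
    x1 with E x1 = K^* l2^*, Q x1 = l^*. Symmetry of Q^* E makes l^* isotropic for K, so K l^* = - E
    x0. The third relation then gives x1^* Q^* E x1 = 0, whence E^* Q x1 = E^* l^* = 0. *)
Lemma left_chain l l2 l3 : l *m A = 0 -> l2 *m A = l *m E -> l2 *m E = l3 *m A ->
  l *m E = 0.
Proof.
have [K eA disK] := dissip_factor.
move=> lA l2A l2E.
have E1 : adjmx Q *m (adjmx K *m adjmx l) = 0.
  by rewrite mulmxA -!adjmxM -eA lA adjmx0.
have E2 : adjmx Q *m (adjmx K *m adjmx l2) = adjmx E *m adjmx l.
  by rewrite mulmxA -!adjmxM -eA l2A.
have E3 : adjmx E *m adjmx l2 = adjmx Q *m (adjmx K *m adjmx l3).
  by rewrite mulmxA -!adjmxM -eA l2E.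
have [|x0 [Ex0 Qx0]] := @lagrangian (adjmx K *m adjmx l) 0; first by rewrite mulmx0.
have [x1 [Ex1 Qx1]] := lagrangian E2.
have x0Q : adjmx x0 *m adjmx Q = 0 by rewrite -adjmxM Qx0 adjmx0.
have QEx0 : adjmx Q *m (E *m x0) = 0 by rewrite mulmxA -adj_QE -mulmxA Qx0 mulmx0.
have Kl : K *m adjmx l = - (adjmx K *m adjmx l).
  apply: oppr_inj; rewrite opprK -dissip_isotropic // adjmxK.
  have : adjmx (Q *m x1) *m (E *m x0) = 0 by rewrite adjmxM -mulmxA QEx0 mulmx0.
  rewrite Qx1 Ex0 adjmxK => /(congr1 (@adjmx R k 1 1)).
  by rewrite !adjmxM !adjmxK adjmx0.
have h : adjmx x1 *m (adjmx Q *m E) *m x1 = 0.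
  rewrite mulmxA -adjmxM Qx1 -mulmxA Ex1 mulmxA -adjmxM Kl adjmxN mulNmx -Ex0.
  by rewrite adjmxM -mulmxA E3 (mulmxA (adjmx x0)) x0Q mul0mx oppr0.
have := psd_ker psdE h; rewrite -adj_QE -mulmxA Qx1 -adjmxM => /(congr1 (@adjmx R k n 1)).
by rewrite adjmxK adjmx0.
Qed.

End Necessity.
End Structured.

(** * Unit vectors and their chains in Kronecker blocks *)

Section UnitVectors.
Variable F : fieldType.

(* Both unit vectors vanish when [n <= j]. *)
Definition dv n j : 'cV[F]_n := \col_i (i == j :> nat)%:R.
Definition rv n j : 'rV[F]_n := \row_i (i == j :> nat)%:R.

Lemma mul_dv m n j (lt : (j < n)%N) (X : 'M[F]_(m, n)) :
  X *m dv n j = \col_i X i (Ordinal lt).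
Proof.
have -> : dv n j = delta_mx (Ordinal lt) 0.
  by apply/matrixP => i l; rewrite !mxE ord1 eqxx andbT.
by rewrite -colE; apply/matrixP => i l; rewrite !mxE.
Qed.

Lemma rv_mul m n i (lt : (i < m)%N) (X : 'M[F]_(m, n)) :
  rv m i *m X = \row_j X (Ordinal lt) j.
Proof.
have -> : rv m i = delta_mx 0 (Ordinal lt).
  by apply/matrixP => j l; rewrite !mxE ord1 eqxx.
by rewrite -rowE; apply/matrixP => j l; rewrite !mxE.
Qed.

Lemma rv_dv n j : (j < n)%N -> rv n j *m dv n j = 1%:M.
Proof.
by move=> lt; rewrite (mul_dv lt); apply/matrixP => i l; rewrite !ord1 !mxE !eqxx.
Qed.

Lemma rv_dv_neq0 n j : (j < n)%N -> rv n j *m dv n j <> 0.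
Proof. by move/rv_dv -> => /matrixP /(_ 0 0) /eqP; rewrite !mxE eqxx oner_eq0. Qed.

Lemma dv_neq0 n j : (j < n)%N -> dv n j <> 0.
Proof. by move=> lt d0; apply: (rv_dv_neq0 lt); rewrite d0 mulmx0. Qed.

Lemma rv_ge n : rv n n = 0.
Proof. by apply/matrixP => j i; rewrite !mxE; have := ltn_ord i; case: eqP => //; lia. Qed.

Lemma rightE_dv e j : (j < e.+1)%N -> kbE (KRight e) *m dv e.+1 j = dv e j.
Proof. by move=> lt; rewrite (mul_dv lt); apply/matrixP => i l; rewrite !mxE. Qed.

Lemma rightA_dv0 e : kbA (KRight e) *m dv e.+1 0 = 0.
Proof. by rewrite (mul_dv (ltn0Sn _)); apply/matrixP => i l; rewrite !mxE. Qed.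

Lemma rightA_dv e j : (j < e)%N -> kbA (KRight e) *m dv e.+1 j.+1 = dv e j.
Proof.
move=> lt; have lt' : (j.+1 < e.+1)%N by [].
by rewrite (mul_dv lt'); apply/matrixP => i l; rewrite !mxE.
Qed.

Lemma rv_rightE e i : (i < e)%N -> rv e i *m kbE (KRight e) = rv e.+1 i.
Proof.
by move=> lt; rewrite (rv_mul lt); apply/matrixP => j l; rewrite !mxE eq_sym.
Qed.

Lemma rv_rightA e i : (i < e)%N -> rv e i *m kbA (KRight e) = rv e.+1 i.+1.
Proof.
by move=> lt; rewrite (rv_mul lt); apply/matrixP => j l; rewrite !mxE eq_sym.
Qed.

Lemma tr_dv n j : (dv n j)^T = rv n j.
Proof. by apply/matrixP => i l; rewrite !mxE. Qed.

Lemma tr_rv n j : (rv n j)^T = dv n j.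
Proof. by rewrite -tr_dv trmxK. Qed.

Lemma rv_leftE e j : (j < e.+1)%N -> rv e.+1 j *m kbE (KLeft e) = rv e j.
Proof. by move=> lt; rewrite -!tr_dv -trmx_mul; congr (_^T); apply: rightE_dv. Qed.

Lemma rv_leftA0 e : rv e.+1 0 *m kbA (KLeft e) = 0.
Proof.
rewrite -!tr_dv -trmx_mul; apply: (can_inj (@trmxK _ _ _)).
by rewrite trmxK trmx0; apply: rightA_dv0.
Qed.

Lemma rv_leftA e j : (j < e)%N -> rv e.+1 j.+1 *m kbA (KLeft e) = rv e j.
Proof. by move=> lt; rewrite -!tr_dv -trmx_mul; congr (_^T); apply: rightA_dv. Qed.

Lemma jordan_dv0 n z : (0 < n)%N -> jordan_block n z *m dv n 0 = z *: dv n 0.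
Proof.
move=> lt; rewrite (mul_dv lt); apply/matrixP => i l; rewrite !mxE addr0.
by rewrite -[z *+ _]mulr_natr; congr (_ * _%:R).
Qed.

Lemma jordan_dv n z j : (j.+1 < n)%N -> jordan_block n z *m dv n j.+1 = z *: dv n j.+1 + dv n j.
Proof.
move=> lt; rewrite (mul_dv lt); apply/matrixP => i l; rewrite !mxE -[z *+ _]mulr_natr.
by congr (_ * _%:R + _).
Qed.

Lemma rv_jordan n z j : (j < n)%N -> rv n j *m jordan_block n z = z *: rv n j + rv n j.+1.
Proof.
move=> lt; rewrite (rv_mul lt); apply/matrixP => l i; rewrite !mxE -[z *+ _]mulr_natr.
by congr (_ * _ + _); rewrite eq_sym.
Qed.

End UnitVectors.

(** * Necessary conditions on a Kronecker block *)

Section BlockConditions.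
Variable R : realType.
Local Notation C := R[i].

(** The conditions of both parts of the theorem on one block. The boolean [~~ strict], read as 0 or
    1, bounds the right minimal index. *)
Definition kblock_ok (strict : bool) (b : kblock C) : bool :=
  match b with
  | KRight eps => (eps <= ~~ strict)%N
  | KLeft eta => eta == 0%N
  | KFinite rho z => (complex.Re z <= 0) &&
      ((complex.Re z == 0) ==>
       (rho <= 1)%N || [&& ~~ strict, z == 0 & (rho <= 2)%N])
  | KInfinite sigma => (sigma <= 2)%N
  end.

Local Notation hstructC := (@hstruct R ComplexField).

(** The unit vectors of the block, carried over to the ambient pencil, form the right and left
    chains of the preceding lemmas. A block that is too large makes a pairing or a vector vanish
    that is visibly nonzero in the block. *)
Lemma hstruct_block strict n (E A : 'M[C]_n) b :
  hstructC strict E A -> psummand (kb b) (Pen E A) -> kblock_wf b -> kblock_ok strict b.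
Proof.
move=> [Q [psdE disA kerQs kerEQ]] [S [S' [T [T' [s t [hE hA] [hE' hA']]]]]] wf.
have kerQ (x : 'cV_n) : Q *m x = 0 -> A *m x = 0.
  by move/kerQs; case: (strict) => // ->; rewrite mulmx0.
have injQ : strict -> forall x : 'cV_n, adjmx Q *m x = 0 -> x = 0.
  move=> st x Qx; have U : adjmx Q \in unitmx.
    rewrite adjmx_unit; apply: unitmx_inj => v /kerQs.
    by rewrite st.
  by rewrite -[x](mulKmx U) Qx mulmx0.
have cE v : E *m (T *m v) = S *m (kbE b *m v) by rewrite !mulmxA -hE.
have cA v : A *m (T *m v) = S *m (kbA b *m v) by rewrite !mulmxA -hA.
have rE u : u *m S' *m E = u *m kbE b *m T' by rewrite -!mulmxA -hE'.
have rA u : u *m S' *m A = u *m kbA b *m T' by rewrite -!mulmxA -hA'.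
have SS (u : 'rV_(krows b)) (v : 'cV_(krows b)) : u *m S' *m (S *m v) = u *m v.
  by rewrite mulmxA -(mulmxA u) s mulmx1.
have injS (v : 'cV_(krows b)) : S *m v = 0 -> v = 0.
  by move=> Sv; rewrite -[v]mul1mx -s -mulmxA Sv mulmx0.
have injT' (u : 'rV_(kcols b)) : u *m T' = 0 -> u = 0.
  by move=> Tu; rewrite -[u]mulmx1 -t mulmxA Tu mul0mx.
case: b S S' T T' s t hE hA hE' hA' wf cE cA rE rA SS injS injT'
  => [e|e|r z|m] S S' T T' s t hE hA hE' hA' wf cE cA rE rA SS injS injT'.
(* The columns form a chain starting in ker A. In the strict case two of its vectors contradict the
   injectivity of the adjoint of Q; otherwise three contradict [null_chain3]. *)
- rewrite /=; case: (leqP e (~~ strict)) => // lt.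
  have e0 : (0 < e)%N by apply: leq_ltn_trans lt.
  have Ax0 : A *m (T *m dv _ _ 0) = 0 by rewrite cA rightA_dv0 mulmx0.
  have Ax1 : A *m (T *m dv _ _ 1) = E *m (T *m dv _ _ 0).
    by rewrite cA cE rightA_dv // rightE_dv.
  have [st|st] := boolP strict.
    have := chain_isotropic psdE disA (_ : adjmx Q *m (A *m (T *m dv _ _ 0)) = 0) Ax1.
    rewrite Ax0 mulmx0 => /(_ erefl) /(injQ st).
    by rewrite cE rightE_dv // => /injS /dv_neq0; case.
  rewrite st /= in lt.
  have Ax2 : A *m (T *m dv _ _ 2) = E *m (T *m dv _ _ 1).
    by rewrite cA cE rightA_dv // rightE_dv // ltnS ltnW.
  have lA : (rv _ e 0 *m S') *m A = (rv _ e 1 *m S') *m E.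
    by rewrite rA rE rv_rightA // rv_rightE.
  have := null_chain3 psdE disA kerQ kerEQ Ax0 Ax1 Ax2 lA.
  by rewrite -mulmxA cE rightE_dv // SS => /rv_dv_neq0; case.
- rewrite /=; case: e S S' T T' s t hE hA hE' hA' wf cE cA rE rA SS injS injT' => // e.
  move=> S S' T T' s t hE hA hE' hA' wf cE cA rE rA SS injS injT'.
  have lA : (rv _ e.+2 0 *m S') *m A = 0 by rewrite rA rv_leftA0 mul0mx.
  have l2A : (rv _ e.+2 1 *m S') *m A = (rv _ e.+2 0 *m S') *m E.
    by rewrite rA rE rv_leftA // rv_leftE.
  (* The third left vector. For left index one the chain ends here: the unit vector is out of range
     and equals zero. *)
  have [u eu] : exists u, rv C e.+1 1 = u *m kbA (KLeft e.+1).
    case: (e) => [|e']; first by exists 0; rewrite rv_ge mul0mx.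
    by exists (rv C e'.+3 2); rewrite rv_leftA.
  have l2E : (rv _ e.+2 1 *m S') *m E = (u *m S') *m A.
    by rewrite rA rE rv_leftE // eu.
  have := left_chain psdE disA kerQ kerEQ lA l2A l2E.
  rewrite rE rv_leftE // => /injT' h.
  by case: (@rv_dv_neq0 C e.+1 0 isT); rewrite h mul0mx.
- have r0 : (0 < r)%N := wf.
  have Ax1 : A *m (T *m dv _ _ 0) = z *: (E *m (T *m dv _ _ 0)).
    by rewrite cA cE mul1mx /= jordan_dv0 // scalemxAr.
  have lA : (rv _ r 0 *m S') *m A = z *: ((rv _ r 0 *m S') *m E) + (rv _ r 1 *m S') *m E.
    by rewrite rA !rE /= !mulmx1 rv_jordan // mulmxDl scalemxAl.
  have lEx : (rv _ r 0 *m S') *m E *m (T *m dv _ _ 0) <> 0.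
    by rewrite -mulmxA cE mul1mx SS; apply: rv_dv_neq0.
  (* The first left vector pairs nontrivially with the eigenvector, so isotropy is possible only for
     z = 0. *)
  have noniso : z != 0 -> adjmx Q *m (E *m (T *m dv _ _ 0)) <> 0.
    by move=> z0 /(eigen_nonisotropic psdE kerQ kerEQ z0 Ax1 lA).
  have Rez : complex.Re z <= 0.
    have [->|z0] := eqVneq z 0; first by [].
    have := eigen_form psdE disA Ax1; set x := T *m _; set a := (_ *m _ *m _) 0 0.
    have a0 : 0 <= a by case: psdE => _; apply.
    have an0 : a != 0.
      apply/eqP => a00; apply: (noniso z0); rewrite mulmxA.
      by apply: (psd_ker psdE); apply/matrixP => i j; rewrite !ord1 [RHS]mxE; exact: a00.
    rewrite pmulr_lge0 ?lt_def ?an0 //.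
    by case: (z) => u v; rewrite lecE /= => /andP[_]; lra.
  rewrite /= Rez /=; apply/implyP => /eqP Rez0.
  case: leqP => //= r2.
  have zz : @ground_conj R ComplexField z + z = 0.
    by case: (z) Rez0 => u v /= ->; apply/eqP; rewrite eq_complex /= addr0 addNr !eqxx.
  have Ax2 : A *m (T *m dv _ _ 1) = z *: (E *m (T *m dv _ _ 1)) + E *m (T *m dv _ _ 0).
    by rewrite cA !cE !mul1mx /= jordan_dv // mulmxDr -scalemxAr.
  (* For z on the imaginary axis, a second chain vector makes the eigenvector isotropic; by [noniso]
     this leaves z = 0. *)
  have iso : adjmx Q *m (E *m (T *m dv _ _ 0)) = 0.
    apply: (chain_isotropic psdE (shift_dissip psdE disA zz) _ (x2 := T *m dv _ _ 1)).
      by rewrite mulmxBl Ax1 -scalemxAl subrr mulmx0.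
    by rewrite mulmxBl Ax2 -scalemxAl addrAC subrr add0r.
  have z0 : z = 0 by apply/eqP; apply/negPn/negP => /noniso.
  rewrite z0 eqxx andTb; have [st|st] /= := boolP strict.
    by move: iso => /(injQ st); rewrite cE mul1mx => /injS /dv_neq0; case.
  rewrite leqNgt; apply/negP => r3.
  have Ax3 : A *m (T *m dv _ _ 2) = z *: (E *m (T *m dv _ _ 2)) + E *m (T *m dv _ _ 1).
    by rewrite cA !cE !mul1mx /= jordan_dv // mulmxDr -scalemxAr.
  rewrite z0 !scale0r !add0r in Ax1 Ax2 Ax3 lA.
  exact: lEx (null_chain3 psdE disA kerQ kerEQ Ax1 Ax2 Ax3 lA).
- rewrite /= leqNgt; apply/negP => m3.
  have m0 : (0 < m)%N by apply: leq_trans m3.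
  have m1 : (1 < m)%N by apply: leq_trans m3.
  have Ex1 : E *m (T *m dv _ _ 0) = 0.
    by rewrite cE /= jordan_dv0 // scale0r mulmx0.
  have Ex2 : E *m (T *m dv _ _ 1) = A *m (T *m dv _ _ 0).
    by rewrite cE cA /= jordan_dv // scale0r add0r mul1mx.
  have Ex3 : E *m (T *m dv _ _ 2) = A *m (T *m dv _ _ 1).
    by rewrite cE cA /= jordan_dv // scale0r add0r mul1mx.
  have lE : (rv _ m 0 *m S') *m E = (rv _ m 1 *m S') *m A.
    by rewrite rA rE /= rv_jordan // scale0r add0r mulmx1.
  have := infinite_chain3 psdE disA kerQ kerEQ Ex1 Ex2 Ex3 lE.
  by rewrite -mulmxA cA mul1mx SS => /rv_dv_neq0; case.
Qed.

End BlockConditions.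

(** * Sufficiency: direct sums, singular and infinite blocks *)

Section Sufficiency.
Variables (R : realType) (k : ground).
Local Notation F := (ground_field R k).

(* A version of [hstruct] for rectangular pencils that is stable under direct
   sums: [N] and [Y] span the part of the kernel and of the cokernel which
   [Q + adjmx Y *m N] matches with each other once the pencil is square. *)
Definition weak (strict : bool) (P : pen F) :=
  exists p q (Q : 'M[F]_(prow P, pcol P)) (N : 'M[F]_(p, pcol P)) (Y : 'M[F]_(q, prow P)),
  [/\ psdmx (adjmx Q *m pE P), dissip (adjmx Q *m pA P),
      [/\ Y *m pE P = 0, Y *m pA P = 0, Y *m Q = 0, Y *m adjmx Y = 1%:M
        & (pcol P + q = prow P + p)%N],
      forall x : 'cV_(pcol P), Q *m x = 0 -> N *m x = 0 ->
        if strict then x = 0 else pA P *m x = 0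
    & forall x : 'cV_(pcol P), pE P *m x = 0 -> Q *m x = 0 -> N *m x = 0 -> x = 0].

(** Squareness gives p = q, so Y^* N is defined. As Y annihilates E, A and Q, adding Y^* N to Q
    changes neither product, and Y Y^* = 1 makes the new kernel the common kernel of Q and N. *)
Lemma weak_square strict n (E A : 'M[F]_n) : weak strict (Pen E A) -> hstruct strict E A.
Proof.
move=> [p [q [Q [N [Y [psdE disA [/= YE YA YQ YY /addnI epq]]]]]]].
subst q => kerQN kerEQN.
have adj0 (X : 'M_n) : Y *m X = 0 -> adjmx (Q + adjmx Y *m N) *m X = adjmx Q *m X.
  by move=> YX; rewrite adjmxD adjmxM adjmxK mulmxDl -mulmxA YX mulmx0 addr0.
have split x : (Q + adjmx Y *m N) *m x = 0 -> Q *m x = 0 /\ N *m x = 0 :> 'cV_(_).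
  move=> Qx; have Nx : N *m x = 0.
    have : Y *m ((Q + adjmx Y *m N) *m x) = 0 by rewrite Qx mulmx0.
    by rewrite mulmxA mulmxDr YQ add0r mulmxA YY mul1mx.
  by split=> //; move: Qx; rewrite mulmxDl -mulmxA Nx mulmx0 addr0.
exists (Q + adjmx Y *m N); rewrite !adj0 //; split=> //.
  by move=> x /split [] ? ?; apply: kerQN.
by move=> x Ex /split [] ? ?; apply: kerEQN.
Qed.

Lemma weak_piso strict P n (E A : 'M[F]_n) :
  weak strict P -> piso P (Pen E A) -> hstruct strict E A.
Proof.
move=> wP e; have := piso_pcol e; have := piso_prow e; move: wP e.
case: P => m m' E' A' wP e /= em em'; subst m m'.
exact: hstruct_iso e (weak_square wP).
Qed.

Lemma hstruct_weak strict n (E A : 'M[F]_n) : hstruct strict E A -> weak strict (Pen E A).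
Proof.
move=> [Q [psdE disA kerQ kerEQ]]; exists 0%N, 0%N, Q, 0, 0; split=> //.
- by split; rewrite ?mul0mx //; apply/matrixP => [[]].
- by move=> x Qx _; apply: kerQ.
- by move=> x Ex Qx _; apply: kerEQ.
Qed.

Lemma hstruct_inj strict n (E A Q : 'M[F]_n) :
  psdmx (adjmx Q *m E) -> dissip (adjmx Q *m A) -> Q \in unitmx -> hstruct strict E A.
Proof.
move=> psdE disA uQ; have inj (x : 'cV_n) : Q *m x = 0 -> x = 0.
  by move=> Qx; rewrite -[x](mulKmx uQ) Qx mulmx0.
exists Q; split => // [x /inj|x _ /inj//].
by case: (strict) => // ->; rewrite mulmx0.
Qed.

Lemma weak_add strict P P' : weak strict P -> weak strict P' -> weak strict (padd P P').
Proof.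
move=> [p [q [Q [N [Y [psdE disA [YE YA YQ YY epq] kerQN kerEQN]]]]]].
move=> [p' [q' [Q' [N' [Y' [psdE' disA' [YE' YA' YQ' YY' epq'] kerQN' kerEQN']]]]]].
exists (p + p')%N, (q + q')%N, (block_mx Q 0 0 Q'), (block_mx N 0 0 N'), (block_mx Y 0 0 Y').
have ker m m' n n' (X : 'M[F]_(m, n)) (X' : 'M_(m', n')) (x : 'cV_n) (x' : 'cV_n') :
    block_mx X 0 0 X' *m col_mx x x' = 0 <-> X *m x = 0 /\ X' *m x' = 0.
  rewrite mul_block_col !mul0mx addr0 add0r; split=> [|[-> ->]]; last by rewrite col_mx0.
  by move=> h; split; [move/(congr1 usubmx): h; rewrite col_mxKu
                      |move/(congr1 dsubmx): h; rewrite col_mxKd]; rewrite linear0.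
split=> /=.
- rewrite adjmx_block !adjmx0 mulmx_block !mul0mx !mulmx0 !addr0 !add0r.
  exact: psd_block.
- rewrite adjmx_block !adjmx0 mulmx_block !mul0mx !mulmx0 !addr0 !add0r.
  exact: dissip_block.
- split; rewrite ?adjmx_block ?adjmx0 ?mulmx_block ?mul0mx ?mulmx0 ?addr0 ?add0r.
  + by rewrite YE YE' block_mx0.
  + by rewrite YA YA' block_mx0.
  + by rewrite YQ YQ' block_mx0.
  + by rewrite YY YY' -scalar_mx_block.
  + by rewrite addnACA epq epq' addnACA.
- move=> x; rewrite -[x]vsubmxK => /ker [Qx Qx'] /ker [Nx Nx'].
  have := kerQN _ Qx Nx; have := kerQN' _ Qx' Nx'.
  case: (strict) => [-> ->|h' h]; first by rewrite col_mx0.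
  exact/ker.
- move=> x; rewrite -[x]vsubmxK => /ker [Ex Ex'] /ker [Qx Qx'] /ker [Nx Nx'].
  by rewrite (kerEQN _ Ex Qx Nx) (kerEQN' _ Ex' Qx' Nx') col_mx0.
Qed.

Lemma weak_kpen strict s : (forall b, b \in s -> weak strict (kb b)) -> weak strict (kpen s).
Proof.
elim: s => [_|b s IH h].
  have z0 (x : 'cV[F]_0) : x = 0 by apply/matrixP => [[]].
  exists 0%N, 0%N, 0, 0, 0; split=> //=; rewrite ?mulmx0.
  - exact: psd0.
  - by apply: dissip_skew; rewrite adjmx0 oppr0.
  - by split; rewrite ?mul0mx //; apply/matrixP => [[]].
  - by move=> x _ _; rewrite (z0 x); case: (strict); rewrite ?mulmx0.
have wb : weak strict (kb b) by apply: h; rewrite mem_head.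
have ws : weak strict (kpen s) by apply: IH => c cs; apply: h; rewrite inE cs orbT.
exact: (weak_add wb ws).
Qed.

Definition ksing_ok (strict : bool) (T : Type) (b : kblock T) : bool :=
  match b with
  | KRight eps => (eps <= ~~ strict)%N
  | KLeft eta => eta == 0%N
  | KFinite _ _ => true
  | KInfinite sigma => (sigma <= 2)%N
  end.

(** Singular blocks take Q = 0: a zero column contributes N = 1, a zero row Y = 1, and the right
    block of index one takes N = A, whose kernel meets that of E trivially. The infinite block of
    size one takes Q = -1. The one of size two, with nilpotent matrix N, takes Q = N - N^T, so that
    Q^* E = N^* N and Q^* A is skew. *)
Lemma weak_sing strict (b : kblock F) : knonfin b -> ksing_ok strict b -> weak strict (kb b).
Proof.
have row0 m n (X : 'M[F]_(m, n)) : m = 0%N -> X = 0.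
  by move=> m0; apply/matrixP => -[i im]; exfalso; rewrite m0 in im.
case: b => [e|e|//|m] /=.
- case: e => [|[|e]] _ ok; last by case: (strict) ok.
    exists 1%N, 0%N, 0, 1%:M, 0; split=> /=.
    + by rewrite adjmx0 mul0mx; apply: psd0.
    + by rewrite adjmx0 mul0mx; apply: dissip_skew; rewrite adjmx0 oppr0.
    + by split; rewrite ?mul0mx //; apply/matrixP => [[]].
    + by move=> x _; rewrite mul1mx => ->; case: (strict); rewrite ?mulmx0.
    + by move=> x _ _; rewrite mul1mx.
  have {ok} ns : strict = false by case: (strict) ok.
  exists 1%N, 0%N, 0, (kbA (KRight 1)), 0; split=> /=.
  + by rewrite adjmx0 mul0mx; apply: psd0.
  + by rewrite adjmx0 mul0mx; apply: dissip_skew; rewrite adjmx0 oppr0.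
  + by split; rewrite ?mul0mx //; apply/matrixP => [[]].
  + by rewrite ns.
  + move=> x /matrixP /(_ 0 0) E0 _ /matrixP /(_ 0 0) A0; apply/matrixP => i j.
    move: E0 A0; rewrite ord1 !mxE !big_ord_recl !big_ord0 !mxE /= !(mul0r, mul1r, addr0, add0r).
    case: i => [[|[|//]] i2] E0 A0.
      by rewrite -[RHS]E0; congr (x _ _); apply: val_inj.
    by rewrite -[RHS]A0; congr (x _ _); apply: val_inj.
- move=> _ /eqP ->; exists 0%N, 1%N, 0, 0, 1%:M; split=> /=.
  + by rewrite adjmx0 mul0mx; apply: psd0.
  + by rewrite adjmx0 mul0mx; apply: dissip_skew; rewrite adjmx0 oppr0.
  + by split; rewrite ?adjmx1 ?mulmx0 ?mul1mx //; apply/matrixP => i [].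
  + by move=> x _ _; rewrite (row0 _ _ x) //; case: (strict); rewrite ?mulmx0.
  + by move=> x _ _ _; apply: row0.
case: m => [//|[|[|//]]] _ _; apply: hstruct_weak.
  apply: (@hstruct_inj _ _ _ _ (- 1%:M)); rewrite /= ?adjmxN ?adjmx1 ?mulmx1 ?mulNmx ?mul1mx.
  - suff -> : jordan_block 1 0 = 0 :> 'M[F]_1 by rewrite oppr0; apply: psd0.
    by apply/matrixP => i j; rewrite !ord1 !mxE mul0rn addr0.
  - rewrite /dissip adjmxN adjmx1 opprD !opprK; apply: psdD; exact: psd1.
  - have : (- 1%:M) *m (- 1%:M) = 1%:M :> 'M[F]_1 by rewrite mulNmx mulmxN opprK mul1mx.
    by case/mulmx1_unit.
pose N := jordan_block 2 (0 : F).
have NN : N *m N = 0.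
  apply/matrixP => i j; rewrite !mxE !big_ord_recl big_ord0 !mxE /= !mul0rn !add0r.
  by case: i j => [[|[|//]] i2] [[|[|//]] j2]; rewrite /= !(mul0r, mulr0, addr0).
have adjN : adjmx N = N^T.
  apply/matrixP => i j; rewrite !mxE !mul0rn !add0r.
  by case: eqP => _; rewrite ?rmorph1 ?rmorph0.
have TN : N^T *m N = adjmx N *m N by rewrite adjN.
(* In size two, N N^T + N^T N = 1, so the chosen Q is invertible. *)
have sq : (N - N^T) *m (N^T - N) = 1%:M.
  rewrite mulmxBr !mulmxBl NN -trmx_mul NN trmx0 subr0 sub0r opprK.
  apply/matrixP => i j; rewrite !mxE !big_ord_recl !big_ord0 !mxE /= !mul0rn !add0r.
  by case: i j => [[|[|//]] i2] [[|[|//]] j2]; rewrite /= !(mul0r, mulr0, mulr1, addr0, add0r).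
apply: (@hstruct_inj _ _ _ _ (N - N^T)); rewrite /=.
- rewrite adjmxB -adjN adjmxK mulmxBl NN subr0.
  exact: psd_gram.
- by rewrite mulmx1; apply: dissip_skew; rewrite !adjmxB -adjN !adjmxK opprB.
- by case: (mulmx1_unit sq).
Qed.

End Sufficiency.

(** * Sufficiency: Jordan blocks over the complex numbers *)

Section FiniteBlocks.
Variable R : realType.
Local Notation F := (ground_field R ComplexField).
Local Notation cj := (@ground_conj R ComplexField).

Lemma mx_eq_dv m n (X Y : 'M[F]_(m, n)) :
  (forall j, (j < n)%N -> X *m dv F n j = Y *m dv F n j) -> X = Y.
Proof.
move=> h; apply/matrixP => i j; have := h j (ltn_ord j).
rewrite !(mul_dv (ltn_ord j)) => /matrixP /(_ i 0); rewrite !mxE.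
by rewrite (_ : Ordinal _ = j) //; apply: val_inj.
Qed.

Lemma jordan0_dv n j : (j.+1 < n)%N -> jordan_block n (0 : F) *m dv F n j.+1 = dv F n j.
Proof. by move=> lt; rewrite jordan_dv // scale0r add0r. Qed.

Lemma jordan0_dv0 n : (0 < n)%N -> jordan_block n (0 : F) *m dv F n 0 = 0.
Proof. by move=> lt; rewrite jordan_dv0 // scale0r. Qed.

Lemma rv_dv_neq n i j : i != j -> rv F n i *m dv F n j = 0.
Proof.
move=> ij; apply/matrixP => a b; rewrite !mxE big1 // => l _; rewrite !mxE.
have [->|] := eqVneq (l : nat) i; last by rewrite mul0r.
by rewrite (negPf ij) mulr0.
Qed.

Lemma jordan0_gram n : (0 < n)%N ->
  (jordan_block n (0 : F))^T *m jordan_block n 0 = 1%:M - dv F n 0 *m rv F n 0.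
Proof.
move=> n0; apply: mx_eq_dv => -[|j] lt; rewrite mulmxBl -!mulmxA mul1mx.
  by rewrite rv_dv // mulmx1 subrr jordan0_dv0 // mulmx0.
rewrite jordan0_dv // rv_dv_neq // mulmx0 subr0.
by rewrite -[dv F n j]tr_rv -trmx_mul rv_jordan ?scale0r ?add0r ?tr_rv // ltnW.
Qed.

Lemma adj_jordan0 n : adjmx (jordan_block n 0 : 'M[F]_n) = (jordan_block n 0)^T.
Proof.
apply/matrixP => i j; rewrite !mxE !mul0rn !add0r.
by case: eqP => _; rewrite ?rmorph1 ?rmorph0.
Qed.

Lemma adj_rv n j : adjmx (rv F n j) = dv F n j.
Proof. by apply/matrixP => a b; rewrite !mxE; case: eqP => _; rewrite ?rmorph1 ?rmorph0. Qed.

Lemma jordan_blockE n z : jordan_block n z = z%:M + jordan_block n 0 :> 'M[F]_n.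
Proof. by apply/matrixP => i j; rewrite !mxE mul0rn add0r. Qed.

(* With [Q = diag(c^-2i)], [z + z^* = - 2 c] and [N] the nilpotent part of the
   block, [Q N = c^2 N Q], so the dissipation is a completed square plus the
   square of the first coordinate. *)
Lemma hstruct_stable n (z c : F) : (0 < n)%N -> 0 < c -> z + cj z = - (c + c) ->
  hstruct true (1%:M : 'M[F]_n) (jordan_block n z).
Proof.
move=> n0 c0 zc; have cN0 : c != 0 by rewrite gt_eqF.
have cc : cj c^-1 = c^-1 by apply: gconj_ge0; rewrite invr_ge0 ltW.
pose G : 'M[F]_n := diag_mx (\row_i c ^- i); pose Q := G *m G.
pose N : 'M[F]_n := jordan_block n 0.
have G_dv j : G *m dv F n j = c ^- j *: dv F n j.
  apply/matrixP => a b; rewrite mul_diag_mx !mxE.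
  by case: eqP => [->|]; rewrite ?mulr0 ?mulr1.
have aG : adjmx G = G.
  apply/matrixP => a b; rewrite !mxE; rewrite eq_sym; have [->|ab] := eqVneq a b.
    by rewrite !mulr1n gconj_ge0 // invr_ge0 exprn_ge0 // ltW.
  by rewrite !mulr0n rmorph0.
have Q_dv j : Q *m dv F n j = c ^- (j + j) *: dv F n j.
  by rewrite -mulmxA G_dv -scalemxAr G_dv scalerA -invfM -exprD.
have aQ : adjmx Q = Q by rewrite adjmxM aG.
have psdQ : psdmx Q by rewrite /Q -{1}aG; apply: psd_gram.
have uQ : Q \in unitmx.
  rewrite /Q unitmx_mul andbb; apply: unitmx_inj => v Gv; apply/matrixP => i j.
  move/matrixP: Gv => /(_ i j); rewrite mul_diag_mx !mxE => /eqP.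
  by rewrite mulf_eq0 invr_eq0 expf_eq0 (negPf cN0) andbF => /eqP.
clearbody Q; clear G G_dv aG.
have rvQ : rv F n 0 *m Q = rv F n 0.
  by rewrite -[LHS]adjmxK adjmxM adj_rv aQ Q_dv expr0 invr1 scale1r -adj_rv adjmxK.
have QN : Q *m N = (c * c) *: (N *m Q).
  apply: mx_eq_dv => -[|j] lt; rewrite -scalemxAl -!mulmxA Q_dv -scalemxAr.
    by rewrite !jordan0_dv0 // mulmx0 !scaler0.
  rewrite !jordan0_dv // Q_dv scalerA; congr (_ *: _).
  by rewrite addSn addnS !exprS !invfM; field; rewrite ?expf_neq0.
have aN : adjmx N = N^T by apply: adj_jordan0.
have NN : N^T *m N = 1%:M - dv F n 0 *m rv F n 0 by apply: jordan0_gram.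
have eJ : jordan_block n z = z%:M + N by apply: jordan_blockE.
clearbody N.
have NQN : N^T *m Q *m N = (c * c) *: (Q - dv F n 0 *m rv F n 0).
  rewrite -mulmxA QN -scalemxAr mulmxA NN mulmxBl mul1mx.
  by rewrite -(mulmxA (dv _ _ _)) rvQ.
apply: (@hstruct_inj _ _ _ _ _ _ Q).
- by rewrite mulmx1 aQ.
- rewrite aQ /dissip; pose M : 'M[F]_n := 1%:M - c^-1 *: N.
  suff -> : - (Q *m jordan_block n z + adjmx (Q *m jordan_block n z)) =
      c *: (adjmx M *m Q *m M) + c *: (adjmx (rv F n 0) *m rv F n 0).
    by apply: psdD; apply: (psdZ (ltW c0)); [apply: psd_congr | apply: psd_gram].
  have aM : adjmx M = 1%:M - c^-1 *: N^T by rewrite adjmxB adjmx1 adjmxZ cc aN.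
  rewrite aM /M mulmxBr !mulmxBl mulmx1 !mul1mx -!scalemxAl -!scalemxAr mulmx1 NQN adj_rv.
  rewrite adjmxM aQ eJ adjmxD adjmx_scalar aN.
  rewrite mulmxDr mulmxDl mul_mx_scalar mul_scalar_mx.
  rewrite addrACA -scalerDl zc.
  move: (Q *m N) (N^T *m Q) (dv F n 0 *m rv F n 0) => X Y P.
  apply/matrixP => a b; rewrite !mxE; field.
  exact: cN0.
- exact: uQ.
Qed.

Lemma hstruct_strictW k strict n (E A : 'M[ground_field R k]_n) :
  hstruct true E A -> hstruct strict E A.
Proof.
move=> [Q [psdE disA inj kerEQ]]; exists Q; split=> // x /inj ->.
by case: (strict); rewrite ?mulmx0.
Qed.

(** Three cases: an eigenvalue in the open left half plane is covered by [hstruct_stable]; an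
    imaginary one of size one admits Q = 1, since z is skew; the eigenvalue zero of size two is left
    to the weaker condition on the kernel of Q. *)
Lemma hstruct_finite strict n (z : R[i]) : (0 < n)%N -> kblock_ok strict (KFinite n z) ->
  hstruct strict (1%:M : 'M[F]_n) (jordan_block n z).
Proof.
move=> n0 /= /andP[]; rewrite le_eqVlt => /orP[/eqP Rez|Rez _]; last first.
  apply: hstruct_strictW; apply: (@hstruct_stable _ _ ((- complex.Re z)%:C)) => //.
    by change (0 < (- complex.Re z)%:C :> R[i]); rewrite ltcR oppr_gt0.
  apply/eqP; rewrite eq_complex /=; case: (z) => a b /=.
  by apply/andP; split; apply/eqP; ring.
rewrite Rez eqxx /= => /orP[n1|/and3P[st /eqP z0 n2]].
  have en : n = 1%N by lia.
  subst n; apply: hstruct_strictW; apply: (@hstruct_inj _ _ _ _ _ _ 1%:M).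
  - by rewrite mulmx1 adjmx1; apply: psd1.
  - rewrite adjmx1 mul1mx jordan_blockE; have -> : jordan_block 1 0 = 0 :> 'M[F]_1.
      by apply/matrixP => i j; rewrite !ord1 !mxE mul0rn addr0.
    rewrite addr0; apply: dissip_skew; rewrite adjmx_scalar -raddfN; congr (_%:M).
    apply/eqP; rewrite eq_complex /=; case: (z) Rez => a b /= ->.
    by rewrite oppr0 !eqxx.
  - exact: unitmx1.
subst z; have {st} -> : strict = false by case: (strict) st.
have [->|n2'] : n = 1%N \/ n = 2%N by lia.
  exists 1%:M.
  have -> : jordan_block 1 0 = 0 :> 'M[F]_1.
    by apply/matrixP => i j; rewrite !ord1 !mxE mul0rn addr0.
  rewrite adjmx1 !mul1mx; split.
  - exact: psd1.
  - by apply: dissip_skew; rewrite adjmx0 oppr0.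
  - by move=> x _; rewrite mul0mx.
  - by move=> x; rewrite mul1mx.
(* Q is the projection onto the last coordinate: it has the same kernel as the nilpotent block, and
   its product with the block is zero. *)
subst n; exists (dv F 2 1 *m rv F 2 1).
have adj_dv : adjmx (dv F 2 1) = rv F 2 1 by rewrite -adj_rv adjmxK.
have N0 : jordan_block 2 0 = dv F 2 0 *m rv F 2 1.
  apply: mx_eq_dv => -[|[|//]] lt; rewrite -mulmxA.
    by rewrite jordan0_dv0 // rv_dv_neq // mulmx0.
  by rewrite jordan0_dv // rv_dv // mulmx1.
rewrite adjmxM adj_rv adj_dv mulmx1; split.
- by rewrite -adj_dv -{1}[dv F 2 1]adjmxK; apply: psd_gram.
- rewrite N0 -mulmxA (mulmxA (rv F 2 1)) rv_dv_neq // mul0mx mulmx0.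
  by apply: dissip_skew; rewrite adjmx0 oppr0.
- move=> x; rewrite -mulmxA => /(congr1 (mulmx (rv F 2 1))).
  by rewrite !mulmxA rv_dv // mul1mx mulmx0 N0 -mulmxA => ->; rewrite mulmx0.
- by move=> x; rewrite mul1mx.
Qed.

Lemma weak_block strict (b : kblock F) : kblock_wf b -> kblock_ok strict b -> weak strict (kb b).
Proof.
case: b => [e|e|n z|m] wf ok; try exact: weak_sing.
by apply: hstruct_weak; apply: hstruct_finite.
Qed.

End FiniteBlocks.

(** * Passage between real and complex solutions *)

Section RealPart.
Variable R : realType.
Local Notation C := (ground_field R ComplexField).
Local Notation K := (ground_field R RealField).
Local Notation re := (@complex.Re R).

(** The embedding is retyped between the two ground fields so that [adjmx] and [psdmx] apply on both
    sides. *)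
Definition cplx : K -> C := real_complex R.
HB.instance Definition _ := GRing.RMorphism.on cplx.

Lemma map_Re_mull m n p (X : 'M[K]_(m, n)) (M : 'M[C]_(n, p)) :
  map_mx re (map_mx cplx X *m M) = X *m (map_mx re M : 'M[K]_(n, p)).
Proof.
apply/matrixP => i j; rewrite !mxE raddf_sum; apply: eq_bigr => l _; rewrite !mxE.
by case: (M l j) => a b /=; rewrite mul0r subr0.
Qed.

Lemma map_Re_mulr m n p (M : 'M[C]_(m, n)) (X : 'M[K]_(n, p)) :
  map_mx re (M *m map_mx cplx X) = (map_mx re M : 'M[K]_(m, n)) *m X.
Proof.
apply/matrixP => i j; rewrite !mxE raddf_sum; apply: eq_bigr => l _; rewrite !mxE.
by case: (M i l) => a b /=; rewrite mulr0 subr0.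
Qed.

Lemma map_Re_adj m n (M : 'M[C]_(m, n)) :
  map_mx re (adjmx M) = adjmx (map_mx re M : 'M[K]_(m, n)).
Proof. by apply/matrixP => i j; rewrite !mxE; case: (M j i). Qed.

Lemma map_cplx_adj m n (M : 'M[K]_(m, n)) : map_mx cplx (adjmx M) = adjmx (map_mx cplx M).
Proof. by apply/matrixP => i j; rewrite !mxE /= /cplx /= oppr0. Qed.

Lemma map_cplx_eq0 m n (M : 'M[K]_(m, n)) : map_mx cplx M = 0 -> M = 0.
Proof.
move=> M0; apply/matrixP => i j; move/matrixP: M0 => /(_ i j); rewrite !mxE.
by case.
Qed.

Lemma Re_form n (M : 'M[C]_n) (x : 'cV[K]_n) :
  (adjmx x *m (map_mx re M : 'M[K]_n) *m x) 0 0 =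
  re ((adjmx (map_mx cplx x) *m M *m map_mx cplx x) 0 0).
Proof.
by rewrite -map_cplx_adj -map_Re_mull -map_Re_mulr mxE.
Qed.

Lemma psd_Re n (M : 'M[C]_n) : psdmx M -> psdmx (map_mx re M : 'M[K]_n).
Proof.
move=> [hM pM]; split; first by rewrite -map_Re_adj hM.
move=> x; rewrite Re_form; have := pM (map_mx cplx x).
by rewrite lecE => /andP[].
Qed.

(** With leading matrix 1, [Q] is itself Hermitian, so both sign conditions are linear in [Q] and
    survive taking real parts entrywise. *)
Lemma hstruct_Re strict n (A : 'M[K]_n) :
  hstruct strict (1%:M : 'M[C]_n) (map_mx cplx A) -> hstruct strict (1%:M : 'M[K]_n) A.
Proof.
move=> [Q [psdE disA kerQ _]]; rewrite mulmx1 in psdE.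
have aQ : adjmx Q = Q by rewrite -(psd_adj psdE) adjmxK.
rewrite aQ in psdE disA.
have aQr : adjmx (map_mx re Q : 'M[K]_n) = map_mx re Q by rewrite -map_Re_adj aQ.
exists (map_mx re Q); rewrite aQr mulmx1; split.
- exact: psd_Re.
- move: (psd_Re disA); rewrite /dissip; congr psdmx.
  rewrite map_mxN map_mxD; congr (- (_ + _)); first by rewrite map_Re_mulr.
  by rewrite map_Re_adj map_Re_mulr.
(* At a real vector the form of [Q] is a real number equal to the form of its real part. It vanishes
   here, and semidefiniteness puts the vector in the kernel of [Q]. *)
- move=> x Qx; have : Q *m map_mx cplx x = 0.
    apply: (psd_ker psdE); apply/matrixP => i j; rewrite !ord1 [RHS]mxE.
    have := Re_form Q x; rewrite -mulmxA Qx mulmx0 mxE.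
    have [_ /(_ (map_mx cplx x))] := psdE; move: ((_ *m _ *m _) 0 0) => y.
    by case: y => a b; rewrite lecE /= => /andP[/eqP -> _] <-.
  move/kerQ; case: (strict) => [|]; first exact: map_cplx_eq0.
  by rewrite -map_mxM; apply: map_cplx_eq0.
- by move=> x; rewrite mul1mx.
Qed.

Local Notation im := (@complex.Im R).

Lemma cplx_split n (x : 'cV[C]_n) :
  x = map_mx cplx (map_mx re x) + (Complex 0 1 : C) *: map_mx cplx (map_mx im x).
Proof.
apply/matrixP => i j; rewrite !mxE; case: (x i j) => a b.
by apply/eqP; rewrite eq_complex /=; apply/andP; split; apply/eqP; ring.
Qed.

Lemma mul_cplx_eq0 m n (X : 'M[K]_(m, n)) (x : 'cV[C]_n) : map_mx cplx X *m x = 0 <->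
  X *m (map_mx re x : 'cV[K]_n) = 0 /\ X *m (map_mx im x : 'cV[K]_n) = 0.
Proof.
split=> [Xx|[h1 h2]].
  split; first by rewrite -map_Re_mull Xx; apply/matrixP => i j; rewrite !mxE.
  have := congr1 (map_mx im) Xx.
  have -> : map_mx im (map_mx cplx X *m x) = X *m (map_mx im x : 'cV[K]_n).
    apply/matrixP => i j; rewrite !mxE raddf_sum; apply: eq_bigr => l _; rewrite !mxE.
    by case: (x l j) => a b /=; rewrite mul0r addr0.
  by move=> ->; apply/matrixP => i j; rewrite !mxE.
by rewrite [x]cplx_split mulmxDr -scalemxAr -!map_mxM h1 h2 map_mx0 scaler0 addr0.
Qed.

(* With [x = u + i v], the form at [x] is the sum of its values at [u], [v]. *)
Lemma psd_cplx n (M : 'M[K]_n) : psdmx M -> psdmx (map_mx cplx M).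
Proof.
move=> [hM pM]; split; first by rewrite -map_cplx_adj hM.
move=> x; pose u : 'cV[K]_n := map_mx re x; pose v : 'cV[K]_n := map_mx im x.
rewrite [x]cplx_split -/u -/v; move: u v => u v; set ii : C := Complex 0 1.
have iic : ground_conj ii = - ii by apply/eqP; rewrite eq_complex /= oppr0 !eqxx.
have ii2 : ii * ii = -1 by apply/eqP; rewrite eq_complex /=; apply/andP; split; apply/eqP; ring.
have q (y z : 'cV[K]_n) : adjmx (map_mx cplx y) *m map_mx cplx M *m map_mx cplx z =
    map_mx cplx (adjmx y *m M *m z) by rewrite -map_cplx_adj -!map_mxM.
have sym : adjmx v *m M *m u = adjmx u *m M *m v.
  have t (X : 'M[K]_1) : adjmx X = X by apply/matrixP => i j; rewrite !ord1 !mxE.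
  by rewrite -[LHS]t !adjmxM adjmxK hM mulmxA.
rewrite adjmxD adjmxZ iic !(mulmxDl, mulmxDr) -!scalemxAl -!scalemxAr !q sym.
have := pM u; have := pM v; move: (adjmx u *m M *m u) (adjmx v *m M *m v) (adjmx u *m M *m v).
move=> X Y Z; rewrite !mxE => Y0 X0.
have -> : cplx (X 0 0) + - ii * cplx (Z 0 0) + (ii * cplx (Z 0 0) + - ii * (ii * cplx (Y 0 0)))
    = cplx (X 0 0 + Y 0 0).
  rewrite rmorphD /=; ring: ii2.
by rewrite /cplx lecE /= eqxx addr_ge0.
Qed.

Lemma hstruct_cplx strict n (E A : 'M[K]_n) :
  hstruct strict E A -> hstruct strict (map_mx cplx E) (map_mx cplx A).
Proof.
move=> [Q [psdE disA kerQ kerEQ]].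
exists (map_mx cplx Q); rewrite -map_cplx_adj -!map_mxM; split.
- exact: psd_cplx.
- rewrite /dissip -map_cplx_adj -map_mxD -map_mxN; exact: psd_cplx.
- move=> x /mul_cplx_eq0 [/kerQ hu /kerQ hv]; case: (strict) hu hv => [u0 v0|hu hv].
    by rewrite [x]cplx_split u0 v0 map_mx0 scaler0 addr0.
  exact/mul_cplx_eq0.
- move=> x /mul_cplx_eq0 [Eu Ev] /mul_cplx_eq0 [Qu Qv].
  by rewrite [x]cplx_split (kerEQ _ Eu Qu) (kerEQ _ Ev Qv) map_mx0 scaler0 addr0.
Qed.

End RealPart.

(** * From matrices of polynomials to pairs of matrices *)

Section PolynomialPencils.
Variable F : fieldType.

Lemma pencil_coef m n (E A : 'M[F]_(m, n)) i j : pencil E A i j = 'X * (E i j)%:P - (A i j)%:P.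
Proof. by rewrite !mxE. Qed.

Lemma pencil_inj m n (E A E' A' : 'M[F]_(m, n)) :
  pencil E A = pencil E' A' -> E = E' /\ A = A'.
Proof.
move=> /matrixP h; split; apply/matrixP => i j; have := h i j; rewrite !pencil_coef.
  move/(congr1 (fun p : {poly F} => p`_1)).
  by rewrite !coefB !coefXM !coefC /= !subr0.
move/(congr1 (fun p : {poly F} => p`_0)).
by rewrite !coefB !coefXM !coefC /= !sub0r => /oppr_inj.
Qed.

Lemma pencil_mul m n p q (S : 'M[F]_(p, m)) (E A : 'M_(m, n)) (T : 'M_(n, q)) :
  map_mx polyC S *m pencil E A *m map_mx polyC T = pencil (S *m E *m T) (S *m A *m T).
Proof.
by rewrite /pencil mulmxBr mulmxBl -scalemxAr -scalemxAl !map_mxM.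
Qed.

Lemma pencil_equivE n (E A E' A' : 'M[F]_n) :
  pencil_equiv (pencil E A) (pencil E' A') <->
  exists S T, [/\ S \in unitmx, T \in unitmx, E = S *m E' *m T & A = S *m A' *m T].
Proof.
split=> [[S [T [uS uT e]]]|[S [T [uS uT eE eA]]]]; exists S, T.
  by move: e; rewrite pencil_mul => /pencil_inj [eE eA].
by split=> //; rewrite pencil_mul -eE -eA.
Qed.

Lemma pencil_equiv_piso n (E A E' A' : 'M[F]_n) :
  pencil_equiv (pencil E A) (pencil E' A') <-> piso (Pen E A) (Pen E' A').
Proof.
rewrite pencil_equivE; split=> [[S [T [uS uT -> ->]]]|[S [S' [T [T' [e1 e2 e3 e4 [hE hA]]]]]]].
  exists (invmx S), S, T, (invmx T); split; rewrite ?mulVmx ?mulmxV //.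
  by split; rewrite /= -!mulmxA mulKmx.
exists S', T; split; rewrite /= in hE hA *.
- by case: (mulmx1_unit e1).
- by case: (mulmx1_unit e3).
- by rewrite -mulmxA -hE mulmxA e2 mul1mx.
- by rewrite -mulmxA -hA mulmxA e2 mul1mx.
Qed.

Lemma pencil_equiv_cast n m' n' (E A : 'M[F]_n) (E' A' : 'M[F]_(m', n'))
    (e : (m' = n) * (n' = n)) :
  pencil_equiv (pencil E A) (castmx e (pencil E' A')) <-> piso (Pen E A) (Pen E' A').
Proof.
case: e => e1 e2; subst m' n'; rewrite castmx_id; exact: pencil_equiv_piso.
Qed.

Lemma pencil_block m1 n1 m2 n2 (E1 A1 : 'M[F]_(m1, n1)) (E2 A2 : 'M[F]_(m2, n2)) :
  block_mx (pencil E1 A1) 0 0 (pencil E2 A2) =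
  pencil (block_mx E1 0 0 E2) (block_mx A1 0 0 A2).
Proof.
rewrite /pencil !map_block_mx !map_mx0 scale_block_mx opp_block_mx add_block_mx.
by rewrite !scaler0 !subr0.
Qed.

Lemma kblock_mxE b : kblock_mx b = pencil (@kbE F b) (kbA b).
Proof.
case: b => [e|e|r z|m] //=.
by rewrite /right_block /pencil linearB linearZ /= !map_trmx.
Qed.

Lemma kdiag_mxE s : kdiag_mx s = pencil (@kdE F s) (kdA s).
Proof.
elim: s => [|b s IH] /=; last by rewrite kblock_mxE IH pencil_block.
by rewrite /pencil !map_mx0 scaler0 subr0.
Qed.

Lemma kronecker_formE n (E A : 'M[F]_n) s :
  kronecker_form (pencil E A) s <-> all (@kblock_wf F) s /\ piso (Pen E A) (kpen s).
Proof.
rewrite /kronecker_form kdiag_mxE; split=> [[hs [e /pencil_equiv_cast]]|[hs e]] //.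
split=> //; have er := piso_prow e; have ec := piso_pcol e.
by exists (esym er, esym ec); apply/pencil_equiv_cast.
Qed.

End PolynomialPencils.

Lemma map_pencil (F F' : fieldType) (f : {rmorphism F -> F'}) m n (E A : 'M[F]_(m, n)) :
  map_mx (map_poly f) (pencil E A) = pencil (map_mx f E) (map_mx f A).
Proof.
apply/matrixP => i j; rewrite [LHS]mxE !pencil_coef !mxE.
by rewrite rmorphB rmorphM /= map_polyX !map_polyC.
Qed.

(** * The two structured forms in terms of [hstruct] *)

Section Characterization.
Variables (R : realType) (k : ground).
Local Notation F := (ground_field R k).

Lemma half_neq0 : 2%:R != 0 :> F.
Proof. by rewrite pnatr_eq0. Qed.

(** [J] is the skew-Hermitian part of [K] and [Rd] the negative of its Hermitian part. *)
Lemma dissip_split n (K : 'M[F]_n) : dissip K ->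
  exists J Rd : 'M[F]_n, [/\ K = J - Rd, adjmx J = - J & psdmx Rd].
Proof.
move=> dK; have c2 : ground_conj (2%:R^-1 : F) = 2%:R^-1.
  by apply: gconj_ge0; rewrite invr_ge0 ler0n.
exists (2%:R^-1 *: (K - adjmx K)), (2%:R^-1 *: - (K + adjmx K)); split.
- rewrite -scalerBr opprK addrACA addNr addr0 -mulr2n -scaler_nat scalerA.
  by rewrite mulVf ?half_neq0 // scale1r.
- by rewrite adjmxZ c2 adjmxB adjmxK -scalerN opprB.
- by apply: psdZ dK; rewrite invr_ge0 ler0n.
Qed.

Lemma split_dissip n (J Rd : 'M[F]_n) : adjmx J = - J -> psdmx Rd -> dissip (J - Rd).
Proof.
move=> aJ pR; rewrite /dissip adjmxB aJ (psd_adj pR).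
have -> : - (J - Rd + (- J - Rd)) = Rd + Rd by rewrite addrACA subrr add0r opprD !opprK.
exact: psdD.
Qed.

(** Forwards, Q^* (J - R) Q is a congruence of a dissipative matrix. Backwards, [dissip_factor]
    recovers J - R from A and Q, and the pencil itself already has the required form. *)
Lemma dH_hstruct n (E0 A0 : 'M[F]_n) :
  (exists E J Rd Q : 'M[F]_n,
      [/\ pencil_equiv (pencil E0 A0) (pencil E ((J - Rd) *m Q)),
          adjmx J = - J,
          psdmx Rd,
          adjmx Q *m E = adjmx E *m Q /\ psdmx (adjmx Q *m E)
        & regular_pencil (pencil E Q)]) <-> hstruct false E0 A0.
Proof.
split=> [[E [J [Rd [Q [/pencil_equiv_piso e aJ pR [_ psdE] reg]]]]]|[Q [psdE disA kerQ kerEQ]]].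
  apply: hstruct_iso (piso_sym e) _; exists Q; split=> //.
  - by rewrite mulmxA; apply: dissip_congr; apply: split_dissip.
  - by move=> x Qx; rewrite -mulmxA Qx mulmx0.
  - move=> x Ex Qx; apply/eqP/negPn/negP => x0; case/negP: reg.
    have Lx : pencil E Q *m map_mx polyC x = 0.
      by rewrite /pencil mulmxBl -scalemxAl -!map_mxM Ex Qx map_mx0 scaler0 subr0.
    (* A common kernel vector of E and Q is annihilated by the pencil; multiplying by the adjugate,
       the determinant times a nonzero entry vanishes. *)
    have := congr1 (mulmx (\adj (pencil E Q))) Lx.
    rewrite mulmxA mul_adj_mx mul_scalar_mx mulmx0 => /matrixP h.
    have [i xi] : exists i, x i 0 != 0.
      apply: contrapT => nx; case/eqP: x0; apply/matrixP => i j; rewrite ord1 [RHS]mxE.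
      by apply/eqP/negPn/negP => xi; apply: nx; exists i.
    have := h i 0; rewrite !mxE => /eqP; rewrite mulf_eq0 polyC_eq0 (negPf xi) orbF.
    by [].
have [K eA dK] := dissip_factor disA kerQ.
have [J [Rd [eK aJ pR]]] := dissip_split dK.
exists E0, J, Rd, Q; split=> //.
- by rewrite -eK -eA; apply/pencil_equiv_piso; apply: piso_refl.
- by split=> //; rewrite (adj_QE psdE).
have U := addEQ_unit psdE kerEQ.
(* The value of the pencil at -1 is - (E + Q), which is invertible. *)
apply/eqP => d0; have := congr1 (fun p : {poly F} => p.[-1]) d0.
rewrite horner0 -horner_evalE -det_map_mx.
have -> : map_mx (horner_eval (-1 : F)) (pencil E0 Q) = (-1) *: (E0 + Q).
  apply/matrixP => i j; rewrite [LHS]mxE pencil_coef !mxE horner_evalE.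
  by rewrite !hornerE mulrDr !mulN1r.
move/eqP; rewrite detZ mulf_eq0 expf_eq0 oppr_eq0 oner_eq0 andbF /=.
by apply/negP; rewrite -unitfE.
Qed.

(** Forwards, Q = 1. Backwards, Q is invertible, and multiplying the pencil from the left by its
    adjoint gives the required form. *)
Lemma dH_hstruct_strict n (E0 A0 : 'M[F]_n) :
  (exists E J Rd : 'M[F]_n,
      [/\ pencil_equiv (pencil E0 A0) (pencil E (J - Rd)),
          adjmx J = - J,
          psdmx Rd
        & psdmx E]) <-> hstruct true E0 A0.
Proof.
split=> [[E [J [Rd [/pencil_equiv_piso e aJ pR psdE]]]]|[Q [psdE disA kerQ kerEQ]]].
  apply: hstruct_iso (piso_sym e) _; apply: (@hstruct_inj _ _ _ _ _ _ 1%:M).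
  - by rewrite adjmx1 mul1mx.
  - by rewrite adjmx1 mul1mx; apply: split_dissip.
  - exact: unitmx1.
have [J [Rd [eK aJ pR]]] := dissip_split disA.
have U : adjmx Q \in unitmx by rewrite adjmx_unit; apply: unitmx_inj.
exists (adjmx Q *m E0), J, Rd; split=> //; rewrite -eK; apply/pencil_equivE.
exists (invmx (adjmx Q)), 1%:M; split; rewrite ?unitmx_inv ?unitmx1 // mulmx1 mulKmx //.
Qed.

End Characterization.

(** * The conditions of the theorem read block by block *)

Section Kcf.
Variables (R : realType) (k : ground) (n : nat).
Variable L : 'M[{poly ground_field R k}]_n.
Hypothesis wf : all (@kblock_wf R[i]) (kcf L).

Lemma pencil_indexP : reflect
  (forall m, KInfinite m \in kcf L -> (m <= 2)%N) (pencil_index L <= 2)%N.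
Proof.
apply: (iffP (bigmax_leqP_seq _ _ _ _)) => [h m ms|h [e|e|r z|m] bs _] //.
  exact: (h _ ms isT).
exact: h.
Qed.

Lemma finite_size_gt0 z r : partial_multiplicity L z r -> (0 < r)%N.
Proof. by move/(allP wf). Qed.

(** Semisimplicity asks for multiplicities equal to one, the blockwise test for sizes at most one;
    the positive sizes granted by [wf] reconcile them. *)
Lemma kcf_ok :
  [/\ forall z, finite_eigenvalue L z -> complex.Re z <= 0,
       (forall z, finite_eigenvalue L z -> complex.Re z = 0 -> z != 0 ->
          semisimple L z) /\
       (forall rho, partial_multiplicity L 0 rho -> (rho <= 2)%N),
       (pencil_index L <= 2)%N
     & (forall eta, left_minimal_index L eta -> eta = 0%N) /\
       (forall eps, right_minimal_index L eps -> (eps <= 1)%N)] <->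
  all (kblock_ok false) (kcf L).
Proof.
split=> [[ha [hb hb0] /pencil_indexP hc [hl hr]]|/allP h].
  apply/allP => -[e|e|r z|m] bs /=.
  - exact: hr.
  - by apply/eqP/hl.
  - have ez : finite_eigenvalue L z by exists r.
    rewrite ha //=; apply/implyP => /eqP Rez.
    have [z0|z0] := eqVneq z 0; first by rewrite hb0 ?orbT // -z0.
    by rewrite (hb z ez Rez z0 r bs).
  - exact: hc.
split.
- by move=> z [r /h /andP[]].
- split=> [z _ Rez z0 r bs|r /h /andP[_] /=].
    have := h _ bs; rewrite /= Rez eqxx (negPf z0) orbF => /andP[_] r1.
    by have := finite_size_gt0 bs; lia.
  by rewrite !eqxx /=; lia.
- by apply/pencil_indexP => m /h.
- by split=> e /h // /eqP.
Qed.

Lemma kcf_ok_strict :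
  [/\ forall z, finite_eigenvalue L z -> complex.Re z <= 0,
       forall z, finite_eigenvalue L z -> complex.Re z = 0 ->
          semisimple L z,
       (pencil_index L <= 2)%N
     & (forall eta, left_minimal_index L eta -> eta = 0%N) /\
       (forall eps, right_minimal_index L eps -> eps = 0%N)] <->
  all (kblock_ok true) (kcf L).
Proof.
split=> [[ha hb /pencil_indexP hc [hl hr]]|/allP h].
  apply/allP => -[e|e|r z|m] bs /=.
  - by rewrite (hr e bs).
  - by apply/eqP/hl.
  - have ez : finite_eigenvalue L z by exists r.
    rewrite ha //=; apply/implyP => /eqP Rez.
    by rewrite (hb z ez Rez r bs).
  - exact: hc.
split.
- by move=> z [r /h /andP[]].
- move=> z _ Rez r bs.
  have := h _ bs; rewrite /= Rez eqxx orbF => /andP[_] r1.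
  by have := finite_size_gt0 bs; lia.
- by apply/pencil_indexP => m /h.
- by split=> e /h; rewrite /= ?leqn0 => /eqP.
Qed.

End Kcf.

(** * Assembly over the two ground fields *)

Section Main.
Variable R : realType.
Local Notation C := (ground_field R ComplexField).
Local Notation K := (ground_field R RealField).

Lemma complex_eigenvalue m (M : 'M[R[i]]_m.+1) : exists z, M - z%:M \notin unitmx.
Proof.
have /closed_rootP [z] : size (char_poly M) != 1%N by rewrite size_char_poly.
rewrite -eigenvalue_root_char => /eigenvalueP [v vM v0]; exists z.
apply/negP => U; case/eqP: v0; rewrite -(mulmxK U v).
by rewrite mulmxBr vM mul_mx_scalar subrr mul0mx.
Qed.

(** Each block is a summand, which gives necessity; the solutions for the blocks add up, which gives
    sufficiency. The list [s] is arbitrary, so this applies to whichever form [kcf] selects. *)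
Lemma hstruct_kpen strict n (E A : 'M[C]_n) s : all (@kblock_wf C) s ->
  piso (Pen E A) (kpen s) -> hstruct strict E A <-> all (kblock_ok strict) s.
Proof.
move=> /allP wf e; split=> [h|/allP ok].
  apply/allP => b bs; apply: hstruct_block h _ (wf b bs).
  exact: psummand_trans (kpen_summand bs) (psummand_iso (piso_sym e)).
apply: weak_piso (piso_sym e); apply: weak_kpen => b bs.
by apply: weak_block; [apply: wf | apply: ok].
Qed.

Definition pmap (F F' : fieldType) (f : {rmorphism F -> F'}) (P : pen F) :=
  Pen (map_mx f (pE P)) (map_mx f (pA P)).

Lemma pmap_summand (F F' : fieldType) (f : {rmorphism F -> F'}) (P Q : pen F) :
  psummand P Q -> psummand (pmap f P) (pmap f Q).
Proof.
move=> [S [S' [T [T' [s t [hE hA] [hE' hA']]]]]].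
exists (map_mx f S), (map_mx f S'), (map_mx f T), (map_mx f T').
split; rewrite -?map_mxM ?s ?t ?map_mx1 //.
  by split; rewrite /= -!map_mxM ?hE ?hA.
by split; rewrite /= -!map_mxM ?hE' ?hA'.
Qed.

(** Singular and infinite blocks have entries 0 and 1, so complexification gives the complex block
    of the same kind and size, to which the hypothesis applies. *)
Lemma sing_ok_lift strict (b : kblock K) : knonfin b ->
  (forall c : kblock C, kblock_wf c -> psummand (kb c) (pmap (@cplx R) (kb b)) ->
     kblock_ok strict c) -> ksing_ok strict b.
Proof.
case: b => [e|e|//|m] wfb h.
- apply: (h (KRight e)) => //; apply: psummand_iso.
  have -> : pmap (@cplx R) (kb (KRight e)) = kb (KRight e).
    by congr Pen; apply/matrixP => i j; rewrite !mxE rmorph_nat.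
  exact: piso_refl.
- apply: (h (KLeft e)) => //; apply: psummand_iso.
  have -> : pmap (@cplx R) (kb (KLeft e)) = kb (KLeft e).
    by congr Pen; apply/matrixP => i j; rewrite !mxE rmorph_nat.
  exact: piso_refl.
- apply: (h (KInfinite m)) => //; apply: psummand_iso.
  have -> : pmap (@cplx R) (kb (KInfinite m)) = kb (KInfinite m).
    congr Pen; last by rewrite /= map_mx1.
    by apply/matrixP => i j; rewrite !mxE !mul0rn !add0r rmorph_nat.
  exact: piso_refl.
Qed.

(* Over the reals the nonsingular finite part is not split further: its [Q] is
   the real part of a complex one. *)
Lemma hstruct_real strict n (E A : 'M[K]_n) :
  hstruct strict (map_mx (@cplx R) E) (map_mx (@cplx R) A) <-> hstruct strict E A.
Proof.
split=> [h|]; last exact: hstruct_cplx.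
have [s [r [B [hs e]]]] := rational_kronecker (Pen E A).
have summ := psummand_iso (piso_sym e).
apply: weak_piso (piso_sym e); apply: weak_add.
  apply: weak_kpen => b bs; apply: weak_sing; first exact: (allP hs).
  apply: sing_ok_lift; first exact: (allP hs).
  move=> c wfc cb; apply: hstruct_block h _ wfc.
  apply: (psummand_trans cb); apply: (@pmap_summand _ _ (@cplx R) _ (Pen E A)).
  apply: psummand_trans (kpen_summand bs) _.
  exact: psummand_trans (psummand_addl _ _) summ.
apply: hstruct_weak; apply: hstruct_Re.
have [s' hs' e'] := jordan_form (map_mx (@cplx R) B : 'M[R[i]]_r) complex_eigenvalue.
have wf' : all (@kblock_wf C) s' by apply/allP => b /(allP hs'); case: b.
apply/(hstruct_kpen _ wf' e'); apply/allP => b bs.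
apply: hstruct_block h _ (allP wf' b bs).
apply: psummand_trans (kpen_summand bs) (psummand_trans (psummand_iso (piso_sym e')) _).
have := pmap_summand (@cplx R) (psummand_trans (psummand_addr (kpen s) (pfin B)) summ).
by rewrite /pmap /= map_mx1.
Qed.

Lemma kcf_spec (k : ground) n (E A : 'M[ground_field R k]_n) :
  all (@kblock_wf R[i]) (kcf (pencil E A)) /\
  (forall strict, hstruct strict E A <-> all (kblock_ok strict) (kcf (pencil E A))).
Proof.
(* A Kronecker form exists over the complex numbers, so [xget] returns one and not its default
   value. *)
have toC (E' A' : 'M[C]_n) : kronecker_form (pencil E' A') 
    (xget [::] [set s | kronecker_form (pencil E' A') s]%classic).
  have [s wf e] := kronecker_form_exists (Pen E' A') complex_eigenvalue.
  by apply: (@xgetPex _ [::] [set s | kronecker_form (pencil E' A') s]%classic);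
    exists s; apply/kronecker_formE.
case: k E A => E A.
  have eL : map_mx (map_poly (@to_complex R RealField)) (pencil E A) =
      pencil (map_mx (@cplx R) E) (map_mx (@cplx R) A) := map_pencil (@cplx R) E A.
  have [wf e] := (kronecker_formE _ _ _).1 (toC (map_mx (@cplx R) E) (map_mx (@cplx R) A)).
  rewrite -eL in wf e; split=> // strict.
  by rewrite -hstruct_real; apply: hstruct_kpen.
have eL : map_mx (map_poly (@to_complex R ComplexField)) (pencil E A) = pencil E A.
  by apply/matrixP => i j; rewrite mxE map_poly_id.
have [wf e] := (kronecker_formE _ _ _).1 (toC E A).
rewrite -eL in wf e; split=> // strict; exact: hstruct_kpen.
Qed.

End Main.

Theorem theorem3p1 (R : realType) (k : ground) (n : nat)
    (E0 A0 : 'M[ground_field R k]_n) :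
  let L := pencil E0 A0 in
  ((exists E J Rd Q : 'M[ground_field R k]_n,
      [/\ pencil_equiv L (pencil E ((J - Rd) *m Q)),
          adjmx J = - J,
          psdmx Rd,
          adjmx Q *m E = adjmx E *m Q /\ psdmx (adjmx Q *m E)
        & regular_pencil (pencil E Q)])
   <->
   [/\ forall z, finite_eigenvalue L z -> complex.Re z <= 0,
       (forall z, finite_eigenvalue L z -> complex.Re z = 0 -> z != 0 ->
          semisimple L z) /\
       (forall rho, partial_multiplicity L 0 rho -> (rho <= 2)%N),
       (pencil_index L <= 2)%N
     & (forall eta, left_minimal_index L eta -> eta = 0%N) /\
       (forall eps, right_minimal_index L eps -> (eps <= 1)%N)])
  /\
  ((exists E J Rd : 'M[ground_field R k]_n,
      [/\ pencil_equiv L (pencil E (J - Rd)),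
          adjmx J = - J,
          psdmx Rd
        & psdmx E])
   <->
   [/\ forall z, finite_eigenvalue L z -> complex.Re z <= 0,
       forall z, finite_eigenvalue L z -> complex.Re z = 0 ->
          semisimple L z,
       (pencil_index L <= 2)%N
     & (forall eta, left_minimal_index L eta -> eta = 0%N) /\
       (forall eps, right_minimal_index L eps -> eps = 0%N)]).
Proof.
move=> L; have [wf ok] := kcf_spec E0 A0; split.
  by rewrite (dH_hstruct E0 A0) (kcf_ok wf).
by rewrite (dH_hstruct_strict E0 A0) (kcf_ok_strict wf).
Qed.
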